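(* The variety $\mathsf V(S_7)$ has exactly $6$ finitely based subvarieties, namely the trivial variety $\mathbf T$, $\mathsf V(M_2)$, $\mathsf V(S_c(a))$, $\mathsf V(S_c(ab))$, $\mathsf V(M_2,S_c(a))$ and $\mathsf V(M_2,S_c(ab))$; all other subvarieties of $\mathsf V(S_7)$ are nonfinitely based.
   Context: A variety is finitely based if it can be defined by finitely many identities. $S_7$ is the ai-semiring on $\{\infty,a,1\}$ with $x+x=x$, $x+y=\infty$ for $x\neq y$, and commutative multiplication with $\infty$ a zero, $a\cdot a=\infty$, $a\cdot 1=a$, $1\cdot1=1$. All of the following are flat semirings (flat addition $x+x=x$, $x+y=\infty$ for $x\ne y$; $\infty$ a multiplicative zero): $M_2=\{1,\infty\}$ with $1\cdot1=1$; $S_c(a)=\{a,\infty\}$ with $a\cdot a=\infty$; $S_c(ab)=\{a,b,ab,\infty\}$ with $a\cdot b=b\cdot a=ab$ and all other products $\infty$. $\mathsf V(K)$ denotes the variety generated by the algebras in $K$. *)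

(* Defs.v *)
From Stdlib Require Import List.

Record alg : Type := Alg {
  car : Type;
  add : car -> car -> car;
  mul : car -> car -> car
}.

Inductive term : Type :=
| Var : nat -> term
| Add : term -> term -> term
| Mul : term -> term -> term.

Fixpoint eval (A : alg) (v : nat -> car A) (t : term) : car A :=
  match t with
  | Var n => v n
  | Add s u => add A (eval A v s) (eval A v u)
  | Mul s u => mul A (eval A v s) (eval A v u)
  end.

Definition identity : Type := (term * term)%type.

Definition satisfies (A : alg) (e : identity) : Prop :=
  forall v : nat -> car A, eval A v (fst e) = eval A v (snd e).

Definition aclass : Type := alg -> Prop.

Definition Mod (Sigma : identity -> Prop) : aclass :=
  fun A => forall e, Sigma e -> satisfies A e.

Definition Id (K : aclass) : identity -> Prop :=
  fun e => forall A, K A -> satisfies A e.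

Definition same_class (V W : aclass) : Prop := forall A, V A <-> W A.

(* A variety = an equationally defined class (Birkhoff) *)
Definition is_variety (V : aclass) : Prop :=
  exists Sigma : identity -> Prop, same_class V (Mod Sigma).

Definition Vgen (K : aclass) : aclass := Mod (Id K).

Definition subvariety (V W : aclass) : Prop :=
  is_variety V /\ (forall A, V A -> W A).

Definition finitely_based (V : aclass) : Prop :=
  exists Sigma : list identity, same_class V (Mod (fun e => In e Sigma)).

Definition trivial_variety : aclass := fun A => forall x y : car A, x = y.

Inductive S7_car : Type := S7inf | S7a | S7one.

Definition S7_eqb (x y : S7_car) : bool :=
  match x, y with
  | S7inf, S7inf | S7a, S7a | S7one, S7one => true
  | _, _ => false
  end.

Definition S7_add (x y : S7_car) : S7_car := if S7_eqb x y then x else S7inf.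

Definition S7_mul (x y : S7_car) : S7_car :=
  match x, y with
  | S7one, S7one => S7one
  | S7a, S7one | S7one, S7a => S7a
  | _, _ => S7inf
  end.

Definition S7 : alg := Alg S7_car S7_add S7_mul.

Inductive M2_car : Type := M2inf | M2one.

Definition M2_eqb (x y : M2_car) : bool :=
  match x, y with
  | M2inf, M2inf | M2one, M2one => true
  | _, _ => false
  end.

Definition M2_add (x y : M2_car) : M2_car := if M2_eqb x y then x else M2inf.

Definition M2_mul (x y : M2_car) : M2_car :=
  match x, y with
  | M2one, M2one => M2one
  | _, _ => M2inf
  end.

Definition M2 : alg := Alg M2_car M2_add M2_mul.

Inductive Sca_car : Type := Scainf | Scaa.

Definition Sca_eqb (x y : Sca_car) : bool :=
  match x, y with
  | Scainf, Scainf | Scaa, Scaa => true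
  | _, _ => false
  end.

Definition Sca_add (x y : Sca_car) : Sca_car := if Sca_eqb x y then x else Scainf.

Definition Sca_mul (x y : Sca_car) : Sca_car := Scainf.

Definition Sca : alg := Alg Sca_car Sca_add Sca_mul.

Inductive Scab_car : Type := Scabinf | Scaba | Scabb | Scabab.

Definition Scab_eqb (x y : Scab_car) : bool :=
  match x, y with
  | Scabinf, Scabinf | Scaba, Scaba | Scabb, Scabb | Scabab, Scabab => true
  | _, _ => false
  end.

Definition Scab_add (x y : Scab_car) : Scab_car :=
  if Scab_eqb x y then x else Scabinf.

Definition Scab_mul (x y : Scab_car) : Scab_car :=
  match x, y with
  | Scaba, Scabb | Scabb, Scaba => Scabab
  | _, _ => Scabinf
  end.

Definition Scab : alg := Alg Scab_car Scab_add Scab_mul.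

Definition V_S7 : aclass := Vgen (fun A => A = S7).
Definition V_M2 : aclass := Vgen (fun A => A = M2).
Definition V_Sca : aclass := Vgen (fun A => A = Sca).
Definition V_Scab : aclass := Vgen (fun A => A = Scab).
Definition V_M2_Sca : aclass := Vgen (fun A => A = M2 \/ A = Sca).
Definition V_M2_Scab : aclass := Vgen (fun A => A = M2 \/ A = Scab).

Definition six_varieties : list aclass :=
  trivial_variety :: V_M2 :: V_Sca :: V_Scab :: V_M2_Sca :: V_M2_Scab :: nil.

(* Main.v *)
(* Omitting S_c(abc) forces xyz = (xyz)^2 in a subvariety of V(S_7): if u = v
   fails in S_c(abc), substitute words for the variables according to a
   refuting valuation and sum over the cyclic permutations of x, y, z; since
   S_c(abc) divides S_7^3 through (a,1,1), (1,a,1), (1,1,a), in S_7 this sum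
   equals (xyz)^2. The same argument in one and two letters treats S_c(a)
   and S_c(ab). Modulo xyz = (xyz)^2 and finitely many laws of S_7, a
   polynomial either lies above a square, and then above everything with its
   content, or is a bipartite graph plus isolated summands, which S_c(ab)
   recognises through its 2-colourings.

   A subvariety containing S_c(abc) has no finite basis. There are 3-uniform
   hypergraphs in which every small set of edges is a forest, but in which
   no vertex set meets each edge exactly once. The latter makes the sum u of
   all edges satisfy u = u^2 in S_7, which fails in the flat semiring of the
   hypergraph; the former makes that semiring satisfy every identity of
   S_c(abc) in few variables, because a forest has enough rainbow
   3-colourings. The hypergraph has vertex set X, edges {s_1 e, s_2 e, s_3
   e} for three permutations s_i of X, and 3 does not divide |X|: an exact
   hitting set Z would give |X| = 3|Z|. High girth comes from iterating the
   universal mod-2 covering, which multiplies |X| by a power of 2. *)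

Require Import Defs.
From Stdlib Require Import List Arith Classical ClassicalEpsilon FunctionalExtensionality PropExtensionality.
From mathcomp Require all_boot.

Section Development.
(* Local imports, so that [<] is [lt] in the theorem; [Defs] again because
   [List.Add] hides the constructor [Add]. *)
Import all_boot Defs.
Set Implicit Arguments.
Unset Strict Implicit.

(** * Coverings of high girth *)

Definition three : Type := option bool.

Definition shared (X : finType) (s : three -> X -> X) (F : {set X}) (e : X)
    (i : three) : bool :=
  [exists f in F, exists j, ((f, j) != (e, i)) && (s j f == s i e)].

(* The marked incidence [(h, k)] encodes that a tree has a second leaf; without
   it the covering step below fails for two cycles joined by a path. *)
Definition acyclic_upto (X : finType) (s : three -> X -> X) (N : nat) : Prop :=
  forall (F : {set X}) (h : X) (k : three), h \in F -> #|F| <= N ->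
  exists2 e, e \in F &
    forall i j, i != j ->
      ~ ((shared s F e i || ((e, i) == (h, k))) /\
         (shared s F e j || ((e, j) == (h, k)))).

(** The universal mod-2 cover of the incidence graph: one bit per incidence, flipped whenever that
    incidence is crossed. A closed walk lifts to a closed walk only if it crosses every incidence an
    even number of times. *)
Definition lift_type (X : finType) : finType := (X * {ffun X * three -> bool})%type.

Definition lift_map (X : finType) (s : three -> X -> X) (i : three)
    (p : lift_type X) : lift_type X :=
  (s i p.1, [ffun z => p.2 z (+) (z == (p.1, i))]).

Lemma sharedP (X : finType) (s : three -> X -> X) (F : {set X}) e i :
  reflect (exists f j, [/\ f \in F, (f, j) <> (e, i) & s j f = s i e])
          (shared s F e i).
Proof.
apply: (iffP existsP) => [[f /andP[fF /existsP[j /andP[/eqP ne /eqP E]]]]|].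
  by exists f, j; split.
by case=> f [j [fF /eqP ne /eqP E]]; exists f; rewrite fF; apply/existsP; exists j; rewrite ne.
Qed.

Lemma lift_map_inj (X : finType) (s : three -> X -> X) :
  (forall i, injective (s i)) -> forall i, injective (lift_map s i).
Proof.
move=> sI i [e f] [e' f'] [/sI -> /ffunP E]; congr (_, _).
by apply/ffunP=> z; have := E z; rewrite !ffunE /= => /addIb.
Qed.

Lemma lift_acyclic (X : finType) (s : three -> X -> X) N :
  (forall i, injective (s i)) -> acyclic_upto s N ->
  acyclic_upto (lift_map s) N.+1.
Proof.
move=> sI acN F' h' k hF' cF'.
have sI' := lift_map_inj sI.
apply: NNPP => noleaf.
have two e' : e' \in F' -> exists i j, [/\ i != j,
    shared (lift_map s) F' e' i || ((e', i) == (h', k)) &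
    shared (lift_map s) F' e' j || ((e', j) == (h', k))].
  move=> eF; apply: NNPP => no2; apply: noleaf; exists e' => // i j ij [mi mj].
  by apply: no2; exists i, j.
(* If two edges of [F'] had the same projection, the image would have at most [N] edges; marks
   project to marks, so its leaf would contradict [two]. *)
have pinj : {in F' &, injective (@fst X {ffun X * three -> bool})}.
  apply/imset_injP; rewrite eqn_leq leq_imset_card /=.
  apply: leq_trans cF' _; rewrite ltnNge; apply/negP=> cF.
  have [e /imsetP[e' eF' ->] leaf] :=
    acN _ h'.1 k (imset_f (@fst X {ffun X * three -> bool}) hF') cF.
  have down i : shared (lift_map s) F' e' i || ((e', i) == (h', k)) ->
     shared s [set x.1 | x in F'] e'.1 i || ((e'.1, i) == (h'.1, k)).
    case/orP=> [/sharedP[f' [j [fF ne E]]]|/eqP[-> ->]]; last by rewrite eqxx orbT.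
    apply/orP; left; apply/sharedP; exists f'.1, j; split.
    - exact: imset_f.
    - by move=> [E1 ij]; apply: ne; move: E; rewrite ij => /sI' ->.
    - by case: E.
  have [i [j [ij /down mi /down mj]]] := two _ eF'.
  exact: (leaf i j ij).
(* At most one of the two marks on [h'] is the artificial [(h', k)]; the other is a genuine contact
   with some [g']. *)
have [i /sharedP[g' [j [gF ne E]]]] : exists i, shared (lift_map s) F' h' i.
  have [i [j [ij mi mj]]] := two _ hF'.
  case/orP: mi => [|/eqP[Ei]]; first by exists i.
  case/orP: mj => [|/eqP[Ej]]; first by exists j.
  by move: ij; rewrite Ei Ej eqxx.
(* The coordinate [(h'.1, i)] changes exactly when a walk passes through the
   incidence [(h', i)]; it splits F' into two parts meeting only there. *)
pose c (x : lift_type X) : bool := x.2 (h'.1, i).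
have coord x' a y' b : lift_map s a x' = lift_map s b y' ->
    c x' (+) ((x'.1, a) == (h'.1, i)) = c y' (+) ((y'.1, b) == (h'.1, i)).
  by case=> _ /ffunP /(_ (h'.1, i)); rewrite !ffunE ![(h'.1, i) == _]eq_sym.
have inc_eq x' a : x' \in F' -> (x'.1, a) = (h'.1, i) -> (x', a) = (h', i).
  by move=> xF [/pinj -> // ->].
pose F1 := [set x in F' | c x != c h'].
have hF1 : h' \notin F1 by rewrite inE eqxx andbF.
have gF1 : g' \in F1.
  rewrite inE gF; have := coord _ _ _ _ E; rewrite eqxx.
  case: eqP => [/(inc_eq _ _ gF)//|_].
  by rewrite addbF addbT => ->; case: (c h').
have cF1 : #|[set x.1 | x in F1]| <= N.
  apply: leq_trans (leq_imset_card _ _) _; rewrite -ltnS.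
  apply: leq_trans cF'; rewrite [X in _ < X](cardsD1 h') hF' ltnS.
  apply: subset_leq_card; apply/subsetP=> x xF1; rewrite !inE.
  by move: (xF1); rewrite inE => /andP[-> _]; rewrite andbT; apply: contraNneq hF1 => <-.
(* Passing from [F'] to [F1] loses only contacts with [h'] at the vertex of [(g', j)]. Marking that
   incidence makes up for them. *)
have [x /imsetP[x' xF1 ->] leaf] :=
  acN _ g'.1 j (imset_f (@fst X {ffun X * three -> bool}) gF1) cF1.
have [xF cx] : x' \in F' /\ c x' != c h' by apply/andP; move: xF1; rewrite inE.
have down a : shared (lift_map s) F' x' a || ((x', a) == (h', k)) ->
   shared s [set x.1 | x in F1] x'.1 a || ((x'.1, a) == (g'.1, j)).
  case/orP=> [/sharedP[y' [l [yF ney Ey]]]|/eqP[Ex _]]; last first.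
    by move: cx; rewrite Ex eqxx.
  have := coord _ _ _ _ Ey.
  case: (_ =P _ :> X * three) => [/(inc_eq _ _ yF)[Ey1 El] _|_].
    case: eqP => [_|neq]; first by rewrite orbT.
    rewrite orbF; apply/sharedP; exists g'.1, j; split; first exact: imset_f.
      by move=> H; apply: neq; rewrite H.
    by move: Ey E; rewrite Ey1 El => -> [].
  case: eqP => [/(inc_eq _ _ xF)[Ex _]|_]; first by move: cx; rewrite Ex eqxx.
  rewrite !addbF => cyx; apply/orP; left; apply/sharedP; exists y'.1, l; split.
  - by apply: imset_f; rewrite inE yF cyx.
  - by move=> [E1 la]; apply: ney; move: Ey; rewrite la => /sI' ->.
  - by case: Ey.
have [a [b [ab /down ma /down mb]]] := two _ xF.
exact: (leaf a b ab).
Qed.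

Lemma acyclic_exists N : exists (X : finType) (s : three -> X -> X),
  [/\ forall i, injective (s i), acyclic_upto s N & ~~ (3 %| #|X|)].
Proof.
elim: N => [|N [X [s [sI ac c3]]]].
  exists unit, (fun _ x => x); split=> [i x y //||]; last by rewrite card_unit.
  by move=> F h k hF; rewrite leqn0 cards_eq0 => /eqP F0; rewrite F0 inE in hF.
exists (lift_type X), (lift_map s); split.
- exact: lift_map_inj.
- exact: lift_acyclic.
- rewrite card_prod card_ffun card_bool Euclid_dvdM // negb_or c3 /=.
  by rewrite Euclid_dvdX.
Qed.

(** * Rainbow colourings *)

Definition rainbow (X : finType) (s : three -> X -> X) (F : {set X})
    (c : X -> three) : Prop :=
  forall e i j, e \in F -> c (s i e) = c (s j e) -> i = j.

Lemma acyclic_leaf (X : finType) (s : three -> X -> X) N (F : {set X}) h :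
  acyclic_upto s N -> h \in F -> #|F| <= N ->
  exists e p, e \in F /\ forall i, i != p -> ~~ shared s F e i.
Proof.
move=> ac hF cF; have [e eF leaf] := ac F h None hF cF.
case: (pickP (shared s F e)) => [p sp|no]; last first.
  by exists e, None; split=> // i _; rewrite no.
exists e, p; split=> // i ip; apply/negP=> si.
by apply: (leaf i p ip); rewrite si sp.
Qed.

(** The two vertices of the leaf [e] away from [p] lie on no other edge of [F], so they can take the
    two colours left over by [s p e], in either order. *)
Lemma rainbow_extend (X : finType) (s : three -> X -> X) (F : {set X}) e p i0 c0 a :
  e \in F -> (forall i, i != p -> ~~ shared s F e i) -> rainbow s (F :\ e) c0 ->
  i0 != p -> a != c0 (s p e) ->
  exists c, [/\ rainbow s F c, c (s i0 e) = a &
    forall z, (forall i, i != p -> z <> s i e) -> c z = c0 z].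
Proof.
move=> eF free rb ip ac.
have fresh i f j : i != p -> f \in F -> s j f = s i e -> (f, j) = (e, i).
  move=> /free/negP sh fF E; apply: NNPP => ne; apply: sh.
  by apply/sharedP; exists f, j.
have [b ba bc] : exists2 b : three, b != a & b != c0 (s p e).
  by move: a (c0 _) ac => [[]|] [[]|] // _;
    do [by exists (Some true) | by exists (Some false) | by exists None].
exists (fun z => if z == s i0 e then a
          else if [exists i, (i != p) && (z == s i e)] then b else c0 z).
have val i : (if s i e == s i0 e then a
    else if [exists k, (k != p) && (s i e == s k e)] then b else c0 (s i e)) =
    if i == i0 then a else if i == p then c0 (s p e) else b.
  case: eqP => [E|ne]; first by have [->] := fresh _ _ _ ip eF E; rewrite eqxx.
  case: (i =P i0) => [E|_]; first by case: ne; rewrite E.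
  case: existsP => [[k /andP[kp /eqP E]]|no].
    by have [->] := fresh _ _ _ kp eF E; rewrite (negPf kp).
  case: eqP => [->//|/eqP ipn]; case: no; exists i; by rewrite ipn eqxx.
split.
- move=> f i j fF; have [->|fe] := eqVneq f e.
    rewrite !val.
    move: i j i0 p ip a b (c0 _) ac ba bc {free rb fresh val eF fF} .
    by do 4![case=> [[]|]] => //= _; move=> a b d /eqP ? /eqP ? /eqP ? // ?; subst.
  have old k : (if s k f == s i0 e then a
      else if [exists i, (i != p) && (s k f == s i e)] then b else c0 (s k f)) = c0 (s k f).
    case: eqP => [/(fresh _ _ _ ip fF)[E]|_]; first by rewrite E eqxx in fe.
    case: existsP => [[l /andP[lp /eqP /(fresh _ _ _ lp fF)[E]]]|//].
    by rewrite E eqxx in fe.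
  by rewrite !old; apply: rb; rewrite !inE fe.
- by rewrite eqxx.
- move=> z nz; case: eqP => [/(nz _ ip)//|_].
  by case: existsP => [[l /andP[lp /eqP/(nz _ lp)]]|].
Qed.

(** Induction by removing a leaf: with three colours, a free vertex [x] of the leaf can avoid both
    the colour of the attaching vertex and that of [y]. *)
Lemma rainbow_separate (X : finType) (s : three -> X -> X) N (F : {set X}) x y :
  acyclic_upto s N -> #|F| <= N -> x <> y ->
  exists2 c, rainbow s F c & c x <> c y.
Proof.
move=> ac; have [m] := ubnP #|F|; elim: m F x y => // m IH F x y Fm FN xy.
have [F0|[h hF]] := set_0Vmem F.
  exists (fun z => if z == x then None else Some true); last first.
    by rewrite eqxx; case: eqP => [/esym|].
  by move=> e i j; rewrite F0 inE.
have [e [p [eF free]]] := acyclic_leaf ac hF FN.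
have cFe : #|F :\ e| < m by move: Fm; rewrite (cardsD1 e) eF.
have cFeN : #|F :\ e| <= N by apply: leq_trans FN; rewrite subset_leq_card ?subD1set.
wlog: x y xy / (exists2 i, i != p & x = s i e) \/
    (forall z, z = x \/ z = y -> forall i, i != p -> z <> s i e).
  move=> W.
  have [ex|nx] := classic (exists2 i, i != p & x = s i e); first by apply: W => //; left.
  have [ey|ny] := classic (exists2 i, i != p & y = s i e).
    by have [c rc cc] := W y x (nesym xy) (or_introl ey); exists c => //; apply: nesym.
  apply: W => //; right=> z [] -> i ip E; first by apply: nx; exists i.
  by apply: ny; exists i.
have [c0 rc0 cxy] := IH (F :\ e) x y cFe cFeN xy.
case=> [[i ip xE]|no].
  have [[j yE]|yne] := classic (exists j, y = s j e).
    have [a ac0] : exists a, a != c0 (s p e).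
      by case: (c0 _) => [b|]; [exists None|exists (Some true)].
    have [c [rc _ _]] := rainbow_extend eF free rc0 ip ac0.
    exists c => //; rewrite xE yE => /(rc _ _ _ eF) ij.
    by apply: xy; rewrite xE yE ij.
  have [a a1 a2] : exists2 a, a != c0 (s p e) & a != c0 y.
    by move: (c0 _) (c0 _) => [[]|] [[]|];
    do [by exists (Some true) | by exists (Some false) | by exists None].
  have [c [rc ca cold]] := rainbow_extend eF free rc0 ip a1.
  exists c => //; rewrite xE ca cold; first by apply/eqP.
  by move=> k _ yk; apply: yne; exists k.
have [i ip] : exists i, i != p by case: p {free no} => [b|]; [exists None|exists (Some true)].
have [a ac0] : exists a, a != c0 (s p e).
  by case: (c0 _) => [b|]; [exists None|exists (Some true)].
have [c [rc _ cold]] := rainbow_extend eF free rc0 ip ac0.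
by exists c => //; rewrite !cold //; apply: no; [right|left].
Qed.

Lemma rainbow_identify (X : finType) (s : three -> X -> X) N (F : {set X}) x y :
  acyclic_upto s N -> #|F| <= N ->
  (x <> y -> forall e i j, e \in F -> s i e = x -> s j e <> y) ->
  exists2 c, rainbow s F c & c x = c y.
Proof.
move=> ac; have [m] := ubnP #|F|; elim: m F x y => // m IH F x y Fm FN nocommon.
have [F0|[h hF]] := set_0Vmem F.
  by exists (fun=> None) => // e i j; rewrite F0 inE.
have [e [p [eF free]]] := acyclic_leaf ac hF FN.
have cFe : #|F :\ e| < m by move: Fm; rewrite (cardsD1 e) eF.
have cFeN : #|F :\ e| <= N by apply: leq_trans FN; rewrite subset_leq_card ?subD1set.
wlog: x y nocommon / (exists2 i, i != p & x = s i e) \/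
    (forall z, z = x \/ z = y -> forall i, i != p -> z <> s i e).
  move=> W.
  have [ex|nx] := classic (exists2 i, i != p & x = s i e); first by apply: W => //; left.
  have [ey|ny] := classic (exists2 i, i != p & y = s i e).
    have [|c rc cc] := W y x _ (or_introl ey); last by exists c.
    by move=> /nesym xy f i j fF yE xE; apply: (nocommon xy f j i fF).
  apply: W => //; right=> z [] -> i ip E; first by apply: nx; exists i.
  by apply: ny; exists i.
case=> [[i ip xE]|no].
  have [xy|xy] := classic (x = y).
    have [c0 rc0 _] := IH (F :\ e) x y cFe cFeN
      (fun xy f a b fF => nocommon xy f a b (subsetP (subD1set F e) f fF)).
    have [a ac0] : exists a, a != c0 (s p e).
      by case: (c0 _) => [b|]; [exists None|exists (Some true)].
    have [c [rc _ _]] := rainbow_extend eF free rc0 ip ac0.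
    by exists c => //; rewrite xy.
  have yne j : y <> s j e.
    by move=> yE; apply: (nocommon xy e i j eF).
  (* Once [y] is separated from the attaching vertex of the leaf, the colour of [y] is available for
     the free vertex [x]. *)
  have [c0 rc0 cp] := rainbow_separate ac cFeN (nesym (yne p)).
  have a1 : c0 y != c0 (s p e) by apply/eqP/nesym.
  have [c [rc ca cold]] := rainbow_extend eF free rc0 ip a1.
  by exists c => //; rewrite xE ca cold // => k _; apply: yne.
have [c0 rc0 cxy] := IH (F :\ e) x y cFe cFeN
  (fun xy f a b fF => nocommon xy f a b (subsetP (subD1set F e) f fF)).
have [i ip] : exists i, i != p by case: p {free no} => [b|]; [exists None|exists (Some true)].
have [a ac0] : exists a, a != c0 (s p e).
  by case: (c0 _) => [b|]; [exists None|exists (Some true)].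
have [c [rc _ cold]] := rainbow_extend eF free rc0 ip ac0.
by exists c => //; rewrite !cold //; apply: no; [right|left].
Qed.


(** * Hypergraph semirings *)

Inductive hcar (X : Type) : Type := HInf | HTop | HV of X | HP of X.
Arguments HInf {X}.
Arguments HTop {X}.

Definition hadd (X : eqType) (p q : hcar X) : hcar X :=
  match p, q with
  | HTop, HTop => HTop
  | HV x, HV y => if x == y then HV x else HInf
  | HP x, HP y => if x == y then HP x else HInf
  | _, _ => HInf
  end.

(* [HP z] is the product of the two vertices that form an edge with [z]. *)
Definition hmul (X : eqType) (comp : X -> X -> option X) (p q : hcar X) : hcar X :=
  match p, q with
  | HV x, HV y => if comp x y is Some z then HP z else HInf
  | HV x, HP y | HP y, HV x => if x == y then HTop else HInf
  | _, _ => HInf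
  end.

Definition halg (X : eqType) (comp : X -> X -> option X) : alg :=
  @Alg (hcar X) (@hadd X) (hmul comp).

Definition third (i j : three) : option three :=
  match i, j with
  | None, Some b | Some b, None => Some (Some (~~ b))
  | Some true, Some false | Some false, Some true => Some None
  | _, _ => None
  end.

(* S_c(abc) is the hypergraph semiring of a single edge. *)
Definition Scabc : alg := halg third.

(** Two vertices may lie on several edges, so a third vertex is picked. It is unique as soon as sets
    of two edges are acyclic. *)
Definition edge_third (X : finType) (s : three -> X -> X) (x y : X) : option X :=
  [pick z | [exists e, exists i, exists j, exists k,
     [&& i != j, i != k, j != k, s i e == x, s j e == y & s k e == z]]].

Definition hypergraph_alg (X : finType) (s : three -> X -> X) : alg :=
  halg (edge_third s).

Fixpoint vbound (t : term) : nat :=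
  match t with
  | Var n => n.+1
  | Add s u | Mul s u => maxn (vbound s) (vbound u)
  end.

Definition hcol (X : Type) (c : X -> three) (p : hcar X) : hcar three :=
  match p with
  | HInf => HInf
  | HTop => HTop
  | HV x => HV (c x)
  | HP x => HP (c x)
  end.

Lemma third_some i j k : i != j -> i != k -> j != k -> third i j = Some k.
Proof. by move: i j k; do 3![case=> [[]|]]. Qed.

Lemma edge_thirdP (X : finType) (s : three -> X -> X) x y z :
  edge_third s x y = Some z -> exists e i j k,
    [/\ i != j, i != k & j != k] /\ [/\ s i e = x, s j e = y & s k e = z].
Proof.
rewrite /edge_third; case: pickP => // w H [<-].
case/existsP: H => e /existsP[i /existsP[j /existsP[k]]].
case/and5P=> ij ik jk /eqP ex /andP[/eqP ey /eqP ez].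
by exists e, i, j, k.
Qed.

Lemma edge_third_some (X : finType) (s : three -> X -> X) e i j :
  i <> j -> edge_third s (s i e) (s j e) <> None.
Proof.
move=> /eqP ij; rewrite /edge_third; case: pickP => // H _.
have [k [ik jk]] : exists k : three, i != k /\ j != k.
  by move: i j {H ij} => [[]|] [[]|];
    do [by exists (Some true) | by exists (Some false) | by exists None].
have /existsP := H (s k e); case; exists e; apply/existsP; exists i.
by apply/existsP; exists j; apply/existsP; exists k; rewrite ij ik jk !eqxx.
Qed.

Definition vertices_of (X : finType) (f : nat -> hcar X) (n : nat) : {set X} :=
  [set x | [exists k : 'I_n, if f k is HV y then x == y else false]].

Definition incident (X : finType) (s : three -> X -> X) (A : {set X}) : {set X} :=
  [set e | [exists i, s i e \in A]].

Lemma card_vertices_of (X : finType) (f : nat -> hcar X) n :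
  #|vertices_of f n| <= n.
Proof.
have sub : [set Some x | x in vertices_of f n] \subset
   [set (if f k is HV y then Some y else None) | k : 'I_n].
  apply/subsetP=> _ /imsetP[x + ->]; rewrite inE => /existsP[k H].
  by apply/imsetP; exists k => //; case: (f k) H => // y /eqP ->.
have := leq_trans (subset_leq_card sub) (leq_imset_card _ _).
by rewrite card_imset ?card_ord //; apply: Some_inj.
Qed.

Lemma card_incident (X : finType) (s : three -> X -> X) (A : {set X}) :
  (forall i, injective (s i)) -> #|incident s A| <= 3 * #|A|.
Proof.
move=> sI; have -> : incident s A = \bigcup_(i : three) (s i @^-1: A).
  apply/setP=> e; rewrite inE; apply/existsP/bigcupP => [[i H]|[i _]].
    by exists i; rewrite ?inE.
  by rewrite inE; exists i.
have -> : 3 = #|{: three}| by rewrite card_option card_bool.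
rewrite -sum_nat_const.
elim/big_rec2: _ => [|i m B _ IH]; first by rewrite cards0.
apply: leq_trans (leq_card_setU _ _) _; rewrite leq_add //.
by rewrite -(card_imset _ (sI i)) subset_leq_card //;
  apply/subsetP=> _ /imsetP[e + ->]; rewrite inE.
Qed.

Lemma eval_vertex (X : finType) (s : three -> X -> X) f n t x :
  vbound t <= n -> eval (hypergraph_alg s) f t = HV x -> x \in vertices_of f n.
Proof.
elim: t x => [k|t IHt u IHu|t IHt u IHu] x /=.
- move=> kn fk; rewrite inE; apply/existsP; exists (Ordinal kn).
  by rewrite /= fk.
- rewrite geq_max => /andP[/IHt {}IHt _].
  case: (eval (hypergraph_alg s) f t) IHt => //= [|y|y] IHt; case: (eval (hypergraph_alg s) f u) => //= z.
    by case: eqP => // _ [<-]; apply: IHt.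
  by case: eqP.
- move=> _; case: (eval (hypergraph_alg s) f t) => //= y; case: (eval (hypergraph_alg s) f u) => //= z.
  + by case: edge_third.
  + by case: eqP.
  + by case: eqP.
Qed.

(** On nonzero values a rainbow colouring acts as a homomorphism to [Scabc]. Only edges through
    vertices assigned to variables matter, since by [eval_vertex] evaluation creates no new
    vertex. *)
Lemma eval_coloring (X : finType) (s : three -> X -> X) f n t c :
  rainbow s (incident s (vertices_of f n)) c -> vbound t <= n ->
  eval (hypergraph_alg s) f t <> HInf ->
  eval Scabc (fun k => hcol c (f k)) t = hcol c (eval (hypergraph_alg s) f t).
Proof.
move=> rc; elim: t => [//|t IHt u IHu|t IHt u IHu] /=;
  rewrite geq_max => /andP[tn un].
- have := IHt tn; have := IHu un.
  case: (eval (hypergraph_alg s) f t) => [||x|x] //;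
    case: (eval (hypergraph_alg s) f u) => [||y|y] //= IHu' IHt'.
  + by move=> _; rewrite IHu' // IHt'.
  + by case: eqP => // E _; rewrite IHt' // IHu' //= E eqxx.
  + by case: eqP => // E _; rewrite IHt' // IHu' //= E eqxx.
- have := IHt tn; have := IHu un; have := @eval_vertex X s f n t _ tn.
  case: (eval (hypergraph_alg s) f t) => //= x; case: (eval (hypergraph_alg s) f u) => //= y xV.
  + case E: (edge_third s x y) => [z|//] -> // -> //= _.
    have [e [i [j [k [[ij ik jk] [ex ey ez]]]]]] := edge_thirdP E.
    have eF : e \in incident s (vertices_of f n).
      by rewrite inE; apply/existsP; exists i; rewrite ex xV.
    rewrite (@third_some _ _ (c z)) // -?ex -?ey -?ez; apply/eqP=> /(rc _ _ _ eF)/eqP;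
      exact/negP.
  + by case: eqP => // E IHu' IHt' _; rewrite IHt' // IHu' //= E eqxx.
  + by case: eqP => // E IHu' IHt' _; rewrite IHt' // IHu' //= E eqxx.
Qed.

Lemma rainbow_exists (X : finType) (s : three -> X -> X) N (F : {set X}) :
  acyclic_upto s N -> #|F| <= N -> exists c, rainbow s F c.
Proof.
move=> ac FN; have [F0|[h _]] := set_0Vmem F.
  by exists (fun=> None) => e i j; rewrite F0 inE.
have [//|c rc _] := @rainbow_identify X s N F h h ac FN; by exists c.
Qed.

Lemma hcol_inj (X : finType) (s : three -> X -> X) N (F : {set X}) p q :
  acyclic_upto s N -> #|F| <= N ->
  (forall c, rainbow s F c -> hcol c p = hcol c q) -> p = q.
Proof.
move=> ac FN H.
have sep x y : (forall c, rainbow s F c -> c x = c y) -> x = y.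
  move=> K; apply: NNPP => xy; have [c rc] := rainbow_separate ac FN xy.
  by apply; apply: K.
have [c0 /H] := rainbow_exists ac FN.
case: p q H => [||x|x] [||y|y] //= H _; congr (_ _); apply: sep => c /H; by case.
Qed.

(** A zero created in the hypergraph semiring is seen by some colouring: distinct summands can be
    kept distinct, and two vertices on no common edge can be given the same colour, so that their
    product in [Scabc] is zero. *)
Lemma eval_coloring_nonzero (X : finType) (s : three -> X -> X) f n t :
  (forall i, injective (s i)) -> acyclic_upto s (3 * n) -> vbound t <= n ->
  (forall c, rainbow s (incident s (vertices_of f n)) c ->
     eval Scabc (fun k => hcol c (f k)) t <> HInf) ->
  eval (hypergraph_alg s) f t <> HInf.
Proof.
move=> sI ac.
have FN : #|incident s (vertices_of f n)| <= 3 * n.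
  by apply: leq_trans (card_incident _ sI) _; rewrite leq_mul2l card_vertices_of.
have val u c (rc : rainbow s (incident s (vertices_of f n)) c) (un : vbound u <= n) :=
  @eval_coloring X s f n u c rc un.
elim: t => [k _|t IHt u IHu|t IHt u IHu] /=.
- have [c0 rc0] := rainbow_exists ac FN.
  by move=> /(_ c0 rc0); case: (f k).
- rewrite geq_max => /andP[tn un] H.
  have nt : eval (hypergraph_alg s) f t <> HInf.
    by apply: IHt tn _ => c /H K E; apply: K; rewrite E.
  have nu : eval (hypergraph_alg s) f u <> HInf.
    by apply: IHu un _ => c /H K E; apply: K; rewrite E; case: (eval Scabc _ t).
  have E : eval (hypergraph_alg s) f t = eval (hypergraph_alg s) f u.
    apply: (hcol_inj ac FN) => c rc; have := H c rc.
    rewrite (val t c rc tn nt) (val u c rc un nu).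
    by case: (eval (hypergraph_alg s) f t) => [||?|?]; case: (eval (hypergraph_alg s) f u) => [||?|?] //=;
      case: eqP => // ->.
  by rewrite -E; case: (eval (hypergraph_alg s) f t) nt => //= x _; rewrite eqxx.
- rewrite geq_max => /andP[tn un] H.
  have nt : eval (hypergraph_alg s) f t <> HInf.
    by apply: IHt tn _ => c /H K E; apply: K; rewrite E.
  have nu : eval (hypergraph_alg s) f u <> HInf.
    by apply: IHu un _ => c /H K E; apply: K; rewrite E; case: (eval Scabc _ t).
  have {}H c (rc : rainbow s (incident s (vertices_of f n)) c) :
      hmul third (hcol c (eval (hypergraph_alg s) f t))
                 (hcol c (eval (hypergraph_alg s) f u)) <> HInf.
    by rewrite -(val t c rc tn nt) -(val u c rc un nu); apply: H.
  have sep x y : (forall c, rainbow s (incident s (vertices_of f n)) c -> c x = c y) -> x = y.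
    by move=> K; have [] : HV x = HV y by apply: (hcol_inj ac FN) => c /K /= ->.
  have [c0 rc0] := rainbow_exists ac FN.
  case: (eval (hypergraph_alg s) f t) nt H => [||x|x] // _; case: (eval (hypergraph_alg s) f u) nu => [||y|y] // _ /= H;
    try by have := H c0 rc0.
  + case E: edge_third => [//|] _.
    suff [c rc cxy] : exists2 c, rainbow s (incident s (vertices_of f n)) c & c x = c y.
      by have := H c rc; rewrite cxy; case: (c y) => [[]|].
    apply: (rainbow_identify ac FN) => xy e i j _ ex ey.
    apply: (@edge_third_some X s e i j); last by rewrite ex ey.
    by move=> ij; apply: xy; rewrite -ex -ey ij.
  + have -> : x = y by apply: sep => c /H; case: eqP.
    by rewrite eqxx.
  + have -> : x = y by apply: sep => c /H; case: eqP.
    by rewrite eqxx.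
Qed.

(** The first [n] variables take at most [n] vertices as values, and each vertex lies on at most
    three edges; hence the bound [3 * n]. *)
Lemma hypergraph_satisfies (X : finType) (s : three -> X -> X) n (e : identity) :
  (forall i, injective (s i)) -> acyclic_upto s (3 * n) ->
  vbound e.1 <= n -> vbound e.2 <= n ->
  satisfies Scabc e -> satisfies (hypergraph_alg s) e.
Proof.
move=> sI ac; case: e => t u /= tn un H f /=.
have FN : #|incident s (vertices_of f n)| <= 3 * n.
  by apply: leq_trans (card_incident _ sI) _; rewrite leq_mul2l card_vertices_of.
wlog nt : t u tn un H / eval (hypergraph_alg s) f t <> HInf.
  move=> W; have [t0|] := classic (eval (hypergraph_alg s) f t = HInf); last exact: W.
  have [u0|nu] := classic (eval (hypergraph_alg s) f u = HInf); first by rewrite t0 u0.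
  by apply/esym/W => // v; apply/esym/H.
have nu : eval (hypergraph_alg s) f u <> HInf.
  apply: (eval_coloring_nonzero sI ac un) => c rc.
  have /= <- := H (fun k => hcol c (f k)).
  by rewrite (eval_coloring rc tn nt); case: (eval (hypergraph_alg s) f t) nt.
apply: (hcol_inj ac FN) => c rc.
by rewrite -(eval_coloring rc tn nt) -(eval_coloring rc un nu); apply: H.
Qed.

(** * The sum of all edges and its square *)

Definition edge_word (X : finType) (s : three -> X -> X) (e : X) : term :=
  let v i := Var (enum_rank (s i e)) in
  Mul (Mul (v None) (v (Some true))) (v (Some false)).

Arguments edge_word : simpl never.

(** There is no empty sum, so the fold starts from the word of [e0], which therefore occurs
    twice. *)
Definition edge_sum (X : finType) (s : three -> X -> X) (e0 : X) : term :=
  foldr (fun e => Add (edge_word s e)) (edge_word s e0) (enum X).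

Lemma eval_edge_sum (X : finType) (s : three -> X -> X) (A : alg) f e0 a :
  add A a a = a ->
  (forall e, eval A f (edge_word s e) = a) -> eval A f (edge_sum s e0) = a.
Proof.
move=> aa H; have evA t u : eval A f (Add t u) = add A (eval A f t) (eval A f u) by [].
rewrite /edge_sum; elim: (enum X) => [|e r IH]; first exact: H.
by rewrite [foldr _ _ _]/= evA H IH.
Qed.

Lemma edge_sum_hypergraph (X : finType) (s : three -> X -> X) N e0 :
  acyclic_upto s N -> 2 <= N ->
  ~ satisfies (hypergraph_alg s) (edge_sum s e0, Mul (edge_sum s e0) (edge_sum s e0)).
Proof.
move=> ac N2.
pose f k := if [pick x | enum_rank x == k :> nat] is Some x then HV x else @HInf X.
have fE x : f (enum_rank x) = HV x.
  rewrite /f; case: pickP => [y /eqP/val_inj/enum_rank_inj -> //|/(_ x)].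
  by rewrite eqxx.
have E : eval (hypergraph_alg s) f (edge_sum s e0) = HTop.
  apply: eval_edge_sum => // e; rewrite /edge_word /= !fE /=.
  case T: edge_third => [z|]; last first.
    by case: (@edge_third_some X s e None (Some true)).
  rewrite /=; suff -> : s (Some false) e = z by rewrite eqxx.
  have [e' [i [j [k [[ij ik jk] [ei ej <-]]]]]] := edge_thirdP T.
  (* If two edges share two vertices, every rainbow colouring of the pair colours their third
     vertices alike, so these coincide. *)
  have FN : #|[set e; e']| <= N by apply: leq_trans N2; rewrite cards2; case: (_ == _).
  suff [] : HV (s (Some false) e) = HV (s k e') by [].
  apply: (hcol_inj ac FN) => c rc /=; congr HV.
  have r1 a b : a != b -> c (s a e) != c (s b e).
    by apply: contraNneq => /(rc _ _ _ (set21 _ _)) ->.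
  have r2 a b : a != b -> c (s a e') != c (s b e').
    by apply: contraNneq => /(rc _ _ _ (set22 _ _)) ->.
  move: (r2 _ _ ik) (r2 _ _ jk) (r2 _ _ ij); rewrite ei ej.
  move: (r1 None (Some false) isT) (r1 (Some true) (Some false) isT).
  move: (c (s None e)) (c (s (Some true) e)) (c (s (Some false) e)) (c (s k e')).
  by do 4![case=> [[]|]].
by move=> /(_ f) /=; rewrite E.
Qed.

Lemma edge_sum_S7 (X : finType) (s : three -> X -> X) e0 :
  (forall i, injective (s i)) -> ~~ (3 %| #|X|) ->
  satisfies S7 (edge_sum s e0, Mul (edge_sum s e0) (edge_sum s e0)).
Proof.
(* Only the value [S7a] could violate the identity. By flatness every edge word then has value
   [S7a], so exactly one vertex of each edge is sent to [S7a]. *)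
move=> sI c3 f /=; case E: (eval S7 f (edge_sum s e0)) => //; case/negP: c3.
have {}E e : eval S7 f (edge_word s e) = S7a.
  have : e \in enum X by rewrite mem_enum.
  have evA t u : eval S7 f (Add t u) = S7_add (eval S7 f t) (eval S7 f u) by [].
  move: E; rewrite /edge_sum; elim: (enum X) => // d r IH.
  rewrite inE [foldr _ _ _]/= evA; case D: (eval S7 f (edge_word s d));
    case: (eval S7 f (foldr _ _ _)) IH => // IH _.
  by case/orP=> [/eqP -> //|]; apply: IH.
pose z (x : X) : nat := if f (enum_rank x) is S7a then 1 else 0.
have one e : z (s None e) + z (s (Some true) e) + z (s (Some false) e) = 1.
  have := E e; rewrite /edge_word /= /z.
  by case: (f _) => //; case: (f _) => //; case: (f _).
(* Double counting: each [s i] is a permutation, so summing over the edges counts every vertex sent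
   to [S7a] three times. *)
have -> : #|X| = \sum_(e : X) 1 by rewrite sum1_card.
under eq_bigr => e _ do rewrite -(one e).
rewrite !big_split /=.
have re i : \sum_e z (s i e) = \sum_x z x by rewrite [RHS](reindex_inj (sI i)).
rewrite !re; set m := \sum_x _.
have -> : m + m + m = 3 * m by rewrite mulSn mul2n -addnn addnA.
exact: dvdn_mulr.
Qed.

Lemma nonfinitely_based (V : aclass) :
  V Scabc -> (forall A, V A -> V_S7 A) -> ~ finitely_based V.
Proof.
move=> VS VS7 [L HL].
(* Starting from 1 ensures [2 <= 3 * n], as [edge_sum_hypergraph] demands. *)
pose n := foldr (fun e : identity => maxn (maxn (vbound e.1) (vbound e.2))) 1 L.
have [X [s [sI ac c3]]] := acyclic_exists (3 * n).
(* An empty [X] would have size 0, a multiple of 3. *)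
have [e0 _] : exists e0 : X, true.
  apply: NNPP => no; case/negP: c3; rewrite (eq_card0 (A := X)) // => x.
  by exfalso; apply: no; exists x.
have n2 : 2 <= 3 * n.
  have : 0 < n by rewrite /n; elim: (L) => //= e r; rewrite leq_max => ->; rewrite orbT.
  by move=> n0; apply: (@leq_trans (3 * 1)); rewrite // leq_mul2l.
apply: (edge_sum_hypergraph (e0 := e0) ac n2).
have /VS7 : V (hypergraph_alg s).
  apply/HL => e eL.
  have [b1 b2] : vbound e.1 <= n /\ vbound e.2 <= n.
    apply/andP; rewrite -geq_max /n; elim: (L) eL => //= d r IH [->|/IH le].
      exact: leq_maxl.
    by apply: leq_trans le _; apply: leq_maxr.
  by apply: (hypergraph_satisfies sI ac b1 b2); move/HL: VS; apply.
by apply=> A ->; apply: edge_sum_S7.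
Qed.

(** * Omitting a generator *)

Fixpoint subst (th : nat -> term) (t : term) : term :=
  match t with
  | Var n => th n
  | Add s u => Add (subst th s) (subst th u)
  | Mul s u => Mul (subst th s) (subst th u)
  end.

Lemma eval_subst A v th t :
  eval A v (subst th t) = eval A (fun k => eval A v (th k)) t.
Proof. by elim: t => //= s -> u ->. Qed.

Lemma eval_ext A v v' t : (forall k, v k = v' k) -> eval A v t = eval A v' t.
Proof. by move=> vv; elim: t => //= s -> u ->. Qed.

(** [B] is the image under [g] of the subalgebra [D] of [A], and [h] selects preimages; this
    transfers identities from [A] to its divisor [B]. *)
Lemma eval_divisor A B (h : car B -> car A) (D : car A -> Prop) (g : car A -> car B) v t :
  (forall b, D (h b)) -> (forall b, g (h b) = b) ->
  (forall x y, D x -> D y -> D (add A x y) /\ g (add A x y) = add B (g x) (g y)) ->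
  (forall x y, D x -> D y -> D (mul A x y) /\ g (mul A x y) = mul B (g x) (g y)) ->
  D (eval A (fun k => h (v k)) t) /\ g (eval A (fun k => h (v k)) t) = eval B v t.
Proof.
move=> Dh gh Dadd Dmul; elim: t => //= s [Ds <-] u [Du <-].
  exact: Dadd.
exact: Dmul.
Qed.

Definition prod_alg (A B : alg) : alg :=
  @Alg (car A * car B)
       (fun p q => (add A p.1 q.1, add B p.2 q.2))
       (fun p q => (mul A p.1 q.1, mul B p.2 q.2)).

Arguments prod_alg : simpl never.

Lemma eval_prod A B v t :
  eval (prod_alg A B) v t =
  (eval A (fun k => (v k).1) t, eval B (fun k => (v k).2) t).
Proof.
elim: t => [n|s IHs u IHu|s IHs u IHu]; first by rewrite /=; case: (v n).
- by rewrite [LHS]/= -/(prod_alg A B) IHs IHu.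
- by rewrite [LHS]/= -/(prod_alg A B) IHs IHu.
Qed.

(* One or two letters are handled with repeated coordinates. *)
Definition S7cube : alg := prod_alg S7 (prod_alg S7 S7).

Definition coord (k : three) (p : car S7cube) : S7_car :=
  match k with None => p.1 | Some true => p.2.1 | Some false => p.2.2 end.

Lemma eval_S7cube v t :
  eval S7cube v t = (eval S7 (fun k => coord None (v k)) t,
    (eval S7 (fun k => coord (Some true) (v k)) t,
     eval S7 (fun k => coord (Some false) (v k)) t)).
Proof. by rewrite /S7cube !eval_prod. Qed.

Arguments S7cube : simpl never.

Definition cube_divisor B (h : car B -> car S7cube) (D : car S7cube -> Prop)
    (g : car S7cube -> car B) : Prop :=
  [/\ forall b, D (h b), forall b, g (h b) = b,
   forall x y, D x -> D y -> D (add _ x y) /\ g (add _ x y) = add B (g x) (g y) &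
   forall x y, D x -> D y -> D (mul _ x y) /\ g (mul _ x y) = mul B (g x) (g y)].

Lemma V_S7_satisfies A e : V_S7 A -> satisfies S7 e -> satisfies A e.
Proof. by move=> VA Se; apply: VA => B ->. Qed.

Definition complete (c : option term) (t : term) : term :=
  if c is Some u then Mul t u else t.

Definition rename (r : nat -> nat) : term -> term := subst (fun n => Var (r n)).

(** Here [wd] represents elements of [B] by words, [co] supplies the factor completing a nonzero
    word to the full product [w], [rots] are symmetries of [w], and [e] is the square to which [w]
    collapses. *)
Lemma collapse_of_absent (V : aclass) (B : alg) (inf : car B)
    (h : car B -> car S7cube) (D : car S7cube -> Prop) (g : car S7cube -> car B)
    (wd : car B -> term) (co : car B -> option term) (w e : term)
    (rots : list (nat -> nat)) :
  is_variety V -> (forall A, V A -> V_S7 A) -> ~ V B ->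
  cube_divisor h D g ->
  (forall b c v, add B b c <> inf -> [/\ b <> inf, c <> inf &
     S7_add (eval S7 v (wd b)) (eval S7 v (wd c)) = eval S7 v (wd (add B b c))]) ->
  (forall b c v, mul B b c <> inf -> [/\ b <> inf, c <> inf &
     S7_mul (eval S7 v (wd b)) (eval S7 v (wd c)) = eval S7 v (wd (mul B b c))]) ->
  (forall b v, b <> inf -> eval S7 v (complete (co b) (wd b)) = eval S7 v w) ->
  (forall r v, In r rots -> eval S7 (fun n => v (r n)) w = eval S7 v w) ->
  (forall v, eval S7 v w = S7inf -> eval S7 v e = S7inf) ->
  (forall v, eval S7 v w = S7one ->
     eval S7 v e = S7one /\ forall b, eval S7 v (wd b) = S7one) ->
  (forall v, eval S7 v w = S7a -> eval S7 v e = S7inf /\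
     forall k, exists2 r, In r rots &
       forall b, eval S7 (fun n => v (r n)) (wd b) = coord k (h b)) ->
  forall A, V A -> satisfies A (w, e).
Proof.
move=> [Sig HV] VS7 nVB [Dh gh Dadd Dmul] wdadd wdmul cow rotw e_inf e_one e_a A VA.
have [[s0 t0] [Sst0 nst0]] : exists d, Sig d /\ ~ satisfies B d.
  apply: NNPP => no; apply: nVB; apply/HV => d Sd.
  by apply: NNPP => nd; apply: no; exists d.
have [phi nphi] := not_all_ex_not _ _ nst0; move: nphi => /= nphi.
have [s [t [st [ns nt]]]] : exists s t, (forall A, V A -> satisfies A (s, t)) /\
    (eval B phi s <> inf /\ eval B phi t <> eval B phi s).
  have st A' : V A' -> satisfies A' (s0, t0) by move=> /HV; apply.
  have [s_inf|] := classic (eval B phi s0 = inf); last first.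
    by move=> ns; exists s0, t0; split=> //; split=> // E; apply: nphi.
  exists t0, s0; split=> [A' /st E v|]; first exact/esym/E.
  by rewrite -s_inf; split=> // E; apply: nphi.
pose m := eval B phi s; pose th n := wd (phi n).
pose T r x := rename r (complete (co m) (subst th x)).
have evT C v r x : eval C v (T r x) =
    eval C (fun n => v (r n)) (complete (co m) (subst th x)).
  by rewrite /T /rename eval_subst.
have word v x : eval B phi x <> inf ->
    eval S7 v (subst th x) = eval S7 v (wd (eval B phi x)).
  elim: x => //= x IHx y IHy.
    by move=> /(wdadd _ _ v) [/IHx -> /IHy -> <-].
  by move=> /(wdmul _ _ v) [/IHx -> /IHy -> <-].
have Ts r : In r rots -> satisfies S7 (T r s, w).
  move=> rr v; rewrite /= evT -(rotw r v rr) -(cow m _ ns).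
  by rewrite /complete; case: (co m) => [c|] /=; rewrite word.
have cancel v x : eval S7 v w <> S7inf -> eval S7 v (complete (co m) x) = eval S7 v w ->
    eval S7 v x = eval S7 v (wd m).
  rewrite -(cow m v ns) /complete; case: (co m) => [c|//] /=.
  by case: (eval S7 v x); case: (eval S7 v c); case: (eval S7 v (wd m)).
have evfold C v r : eval C v (foldr (fun r => Add (T r t)) w r) =
    foldr (fun r => add C (eval C v (T r t))) (eval C v w) r.
  by elim: r => //= r l ->.
(* In [A] every [T r t] equals [T r s], that is [w], so [big] reduces to [w]; in [S7] the same sum
   equals [e]. *)
pose big := foldr (fun r => Add (T r t)) w rots.
have AS7 d := @V_S7_satisfies A d (VS7 A VA).
have bigw : satisfies A (big, w).
  move=> v; rewrite /= evfold.
  have : forall r, In r rots -> eval A v (T r t) = eval A v w.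
    move=> r rr; rewrite -(AS7 _ (Ts r rr)) /= !evT; have /(_ (fun k => eval A (fun n => v (r n)) (th k))) /= E := st A VA.
    by rewrite /complete; case: (co m) => [c|] /=; rewrite !eval_subst E.
  elim: (rots) => //= r l IH H; rewrite IH ?H //; [|by left|by move=> r' r'l; apply: H; right].
  by apply: (AS7 (Add w w, w)) => u /=; case: (eval S7 u w).
suff /AS7 E : satisfies S7 (big, e) by move=> v; rewrite -(bigw v) E.
move=> v /=; rewrite evfold.
have foldinf l : foldr (fun r => S7_add (eval S7 v (T r t))) S7inf l = S7inf.
  by elim: l => //= r l ->; case: (eval S7 v (T r t)).
case E: (eval S7 v w).
- by rewrite foldinf e_inf.
- have [-> rot] := e_a v E.
  (* If [t] agreed with [h m] in every coordinate of the cube, applying [g] would give [s] and [t]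
     the same value in [B]. *)
  have [k nk] : exists k, eval S7 (fun n => coord k (h (phi n))) t <> coord k (h m).
    apply: NNPP => no; apply: nt; rewrite -/m.
    have [_ <-] := eval_divisor phi t Dh gh Dadd Dmul.
    have eqk k : eval S7 (fun n => coord k (h (phi n))) t = coord k (h m).
      by apply: NNPP => nk; apply: no; exists k.
    rewrite eval_S7cube !eqk -[RHS]gh /=.
    by case: (h m) => [? []].
  have [r rr rk] := rot k.
  have ne : eval S7 v (T r t) <> S7a.
    have nz : eval S7 (fun n => v (r n)) w <> S7inf by rewrite rotw // E.
    rewrite evT -E -(rotw r v rr) => /(cancel _ _ nz); rewrite eval_subst rk => K.
    by apply: nk; rewrite -K; apply: eval_ext => n; rewrite rk.
  elim: (rots) rr => //= r' l IH [->|/IH ->]; last by case: (eval S7 v (T r' t)).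
  (* A sum containing [S7a] is never [S7one], so any summand other than [S7a] makes it infinite. *)
  have : foldr (fun r => S7_add (eval S7 v (T r t))) S7a l <> S7one.
    elim: (l) => //= r'' l' IHl; case: (eval S7 v (T r'' t));
      by case: (foldr _ _ _) IHl.
  by case: (eval S7 v (T r t)) ne => // _; case: (foldr _ _ _).
- have [-> one] := e_one v E.
  elim: (rots) (rotw) => //= r l IH H; rewrite IH; last by move=> *; apply: H; right.
  have E1 : eval S7 (fun n => v (r n)) w = S7one by rewrite (H r v) //; left.
  suff -> : eval S7 v (T r t) = S7one by [].
  have [_ oner] := e_one _ E1.
  have all1 x : eval S7 (fun n => v (r n)) (subst th x) = S7one.
    rewrite eval_subst; elim: x => //= [n|x -> y ->|x -> y ->] //.
    exact: oner.
  have := cow m (fun n => v (r n)) ns; rewrite evT E1 /complete.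
  by case: (co m) => [c|] /=; rewrite all1 ?oner.
Qed.

(** * Bases of the six varieties *)

Definition sq (t : term) : term := Mul t t.

Definition xy : term := Mul (Var 0) (Var 1).
Definition xyz : term := Mul (Var 0) (Mul (Var 1) (Var 2)).
Definition path3 : term :=
  Add (Mul (Var 0) (Var 1)) (Add (Mul (Var 1) (Var 2)) (Mul (Var 2) (Var 3))).
Definition tail2 : term := Add (Var 0) (Mul (Var 0) (Var 1)).

(** After the axioms of commutative ai-semirings come three laws of [S7]: the square law makes
    everything above a square depend on content only, the path law closes the graph of two-letter
    summands under walks of length 3, and the tail law keeps isolated summands off the edges. *)
Definition common : list identity :=
  [:: (Add (Add (Var 0) (Var 1)) (Var 2), Add (Var 0) (Add (Var 1) (Var 2)));
      (Add (Var 0) (Var 1), Add (Var 1) (Var 0));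
      (Add (Var 0) (Var 0), Var 0);
      (Mul (Mul (Var 0) (Var 1)) (Var 2), Mul (Var 0) (Mul (Var 1) (Var 2)));
      (Mul (Var 0) (Var 1), Mul (Var 1) (Var 0));
      (Mul (Var 0) (Add (Var 1) (Var 2)),
         Add (Mul (Var 0) (Var 1)) (Mul (Var 0) (Var 2)));
      (Add (sq (Var 0)) (Var 1), sq xy);
      (Add path3 (Mul (Var 0) (Var 3)), path3);
      (Add (Mul (Var 0) (sq (Var 1))) tail2, tail2)].

(** Each absent generator contributes the law that its omission forces. Three values of [k] suffice
    because [Sca] lies in the variety of [Scab]. *)
Definition basis (m : bool) (k : option bool) : list identity :=
  (xyz, sq xyz) :: (if m then [::] else [:: (sq (Var 0), sq xy)]) ++
  (match k with
   | None => [:: (Var 0, sq (Var 0))]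
   | Some false => [:: (xy, sq xy)]
   | Some true => [::]
   end) ++ common.

Definition gens (m : bool) (k : option bool) : aclass :=
  fun A => (m = true /\ A = M2) \/ (k = Some false /\ A = Sca) \/
           (k = Some true /\ A = Scab).

Record laws (A : alg) : Prop := Laws {
  addA : forall x y z, add A (add A x y) z = add A x (add A y z);
  addC : forall x y, add A x y = add A y x;
  addI : forall x, add A x x = x;
  mulA : forall x y z, mul A (mul A x y) z = mul A x (mul A y z);
  mulC : forall x y, mul A x y = mul A y x;
  mulD : forall x y z, mul A x (add A y z) = add A (mul A x y) (mul A x z);
  sq_add : forall x y,
    add A (mul A x x) y = mul A (mul A x y) (mul A x y);
  path_law : forall x y z u,
    add A (add A (mul A x y) (add A (mul A y z) (mul A z u))) (mul A x u) =
    add A (mul A x y) (add A (mul A y z) (mul A z u));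
  tail_law : forall x y,
    add A (mul A x (mul A y y)) (add A x (mul A x y)) = add A x (mul A x y)
}.

Lemma common_laws A : Mod (fun e => In e common) A -> laws A.
Proof.
move=> H.
pose v4 (x y z u : car A) n :=
  match n with 0 => x | 1 => y | 2 => z | _ => u end.
have law i (le : i < 9) x y z u : let e := List.nth i common (Var 0, Var 0) in
    eval A (v4 x y z u) e.1 = eval A (v4 x y z u) e.2.
  by move=> e; apply: H; apply: nth_In; apply/ltP.
split.
- by move=> x y z; apply: (law 0 isT x y z z).
- by move=> x y; apply: (law 1 isT x y y y).
- by move=> x; apply: (law 2 isT x x x x).
- by move=> x y z; apply: (law 3 isT x y z z).
- by move=> x y; apply: (law 4 isT x y y y).
- by move=> x y z; apply: (law 5 isT x y z z).
- by move=> x y; apply: (law 6 isT x y y y).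
- by move=> x y z u; apply: (law 7 isT x y z u).
- by move=> x y; apply: (law 8 isT x y y y).
Qed.

Lemma S7_common e : In e common -> satisfies S7 e.
Proof.
by do 9?[case=> [<- v /=|]] => //;
  case: (v 0) => //; case: (v 1) => //; case: (v 2) => //; case: (v 3).
Qed.

Lemma gens_basis m k B : gens m k B -> Mod (fun e => In e (basis m k)) B.
Proof.
case=> [[-> ->]|[[-> ->]|[-> ->]]] e /=.
- case: k => [[]|] /=; do 12?[case=> [<- v /=|]] => //;
    case: (v 0) => //; case: (v 1) => //; case: (v 2) => //; case: (v 3) => //.
- by case: m => /=; do 12?[case=> [<- v /=|]] => //;
    case: (v 0) => //; case: (v 1) => //; case: (v 2) => //; case: (v 3).
- by case: m => /=; do 12?[case=> [<- v /=|]] => //;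
    case: (v 0) => //; case: (v 1) => //; case: (v 2) => //; case: (v 3).
Qed.

Lemma basis_common m k e : In e common -> In e (basis m k).
Proof. by move=> ec; right; apply/in_app_iff; right; apply/in_app_iff; right. Qed.

(** * The additive order and the words of a term *)

Definition le (A : alg) (x y : car A) : Prop := add A x y = y.
Arguments le : clear implicits.

Lemma le_refl A x : laws A -> le A x x.
Proof. by move=> L; apply: addI. Qed.

Lemma le_trans A x y z : laws A -> le A x y -> le A y z -> le A x z.
Proof. by rewrite /le => L xy' yz; rewrite -yz -(addA L) xy'. Qed.

Lemma le_antisym A x y : laws A -> le A x y -> le A y x -> x = y.
Proof. by rewrite /le => L xy' yx; rewrite -xy' (addC L) yx. Qed.

Lemma le_addl A x y : laws A -> le A x (add A x y).
Proof. by rewrite /le => L; rewrite -(addA L) (addI L). Qed.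

Lemma le_addr A x y : laws A -> le A y (add A x y).
Proof. by move=> L; rewrite (addC L); apply: le_addl. Qed.

Lemma add_le A x y b : laws A -> le A (add A x y) b <-> le A x b /\ le A y b.
Proof.
move=> L; split=> [xyb|[xb yb]]; last by rewrite /le (addA L) yb.
by split; apply: le_trans xyb => //; [apply: le_addl|apply: le_addr].
Qed.

Fixpoint words (t : term) : seq (seq nat) :=
  match t with
  | Var n => [:: [:: n]]
  | Add s u => words s ++ words u
  | Mul s u => [seq a ++ b | a <- words s, b <- words u]
  end.

(* The value on the empty word, which [words] never produces, is junk. *)
Fixpoint wev (A : alg) (v : nat -> car A) (w : seq nat) : car A :=
  match w with
  | [::] => v 0
  | [:: n] => v n
  | n :: r => mul A (v n) (wev v r)
  end.
Arguments wev A v w : clear implicits.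

Lemma words_nonempty t w : w \in words t -> w != [::].
Proof.
elim: t w => [n|s IHs u IHu|s IHs u IHu] w /=.
- by rewrite inE => /eqP ->.
- by rewrite mem_cat => /orP[/IHs|/IHu].
- by case/allpairsP=> [[a b] /= [/IHs + _ ->]]; case: a.
Qed.

Lemma wev_cons A v n r : r != [::] -> wev A v (n :: r) = mul A (v n) (wev A v r).
Proof. by case: r. Qed.

Lemma wev_cat A v a b : laws A -> a != [::] -> b != [::] ->
  wev A v (a ++ b) = mul A (wev A v a) (wev A v b).
Proof.
move=> L + b0; elim: a => // n a IH _; rewrite cat_cons.
case: a IH => [_|m a IH]; first exact: wev_cons.
by rewrite wev_cons // IH // [wev A v (n :: _)]wev_cons // (mulA L).
Qed.

Lemma eval_le_words A v t b : laws A ->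
  le A (eval A v t) b <-> forall w, w \in words t -> le A (wev A v w) b.
Proof.
move=> L.
(* Distributivity is proved with a scalar [c] in front, so that the induction passes through
   products. *)
have scaled t' c : forall b', le A (mul A c (eval A v t')) b' <->
    forall w, w \in words t' -> le A (mul A c (wev A v w)) b'.
  elim: t' c => [n|s IHs u IHu|s IHs u IHu] c b' /=.
  - by split=> [H w|H]; [rewrite inE => /eqP ->|apply: (H [:: n]); rewrite inE].
  - rewrite (mulD L) add_le // IHs IHu; split=> [[Hs Hu] w|H].
      by rewrite mem_cat => /orP[/Hs|/Hu].
    by split=> w wi; apply: H; rewrite mem_cat wi ?orbT.
  - have swap x y : mul A (mul A y c) x = mul A c (mul A x y).
      by rewrite (mulC L y) (mulA L) (mulC L y).
    have rot x y : mul A (mul A c x) y = mul A (mul A y c) x.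
      by rewrite (mulC L) -(mulA L).
    rewrite -(mulA L) IHu; split=> H w.
      case/allpairsP=> [[x y] /= [xs yu ->]].
      rewrite wev_cat ?(words_nonempty xs) ?(words_nonempty yu) //.
      by have := H y yu; rewrite rot IHs => /(_ x xs); rewrite swap.
    move=> wu; rewrite rot IHs => x xs; rewrite swap.
    have := H (x ++ w); rewrite wev_cat ?(words_nonempty xs) ?(words_nonempty wu) //.
    by apply; apply/allpairsP; exists (x, w).
elim: t b => [n|s IHs u IHu|s IHs u IHu] b /=.
- by split=> [H w|H]; [rewrite inE => /eqP ->|apply: (H [:: n]); rewrite inE].
- rewrite add_le // IHs IHu; split=> [[Hs Hu] w|H].
    by rewrite mem_cat => /orP[/Hs|/Hu].
  by split=> w wi; apply: H; rewrite mem_cat wi ?orbT.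
- rewrite scaled; split=> H w.
    case/allpairsP=> [[x y] /= [xs yu ->]].
    rewrite wev_cat ?(words_nonempty xs) ?(words_nonempty yu) // (mulC L).
    by have := H y yu; rewrite (mulC L) scaled => /(_ x xs).
  move=> wu; rewrite (mulC L) scaled => x xs; rewrite (mulC L).
  have := H (x ++ w); rewrite wev_cat ?(words_nonempty xs) ?(words_nonempty wu) //.
  by apply; apply/allpairsP; exists (x, w).
Qed.


Lemma flat_eval B v t b : laws B -> (forall x, le B x b -> x = b) ->
  eval B v t = b <-> forall w, w \in words t -> wev B v w = b.
Proof.
move=> L flat; split=> [E w wt|H].
  apply: flat; move: w wt; rewrite -/(le _ _ _).
  by apply/eval_le_words => //; rewrite E; apply: le_refl.
apply: flat; apply/eval_le_words => // w /H ->; exact: le_refl.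
Qed.

Lemma sq_le_mul A y z b : laws A -> le A (mul A y y) b -> le A z b ->
  le A (mul A (mul A y z) (mul A y z)) b.
Proof. by move=> L yb zb; rewrite -(sq_add L) add_le. Qed.

Lemma le_sq_mul A y z : laws A -> le A z (mul A (mul A y z) (mul A y z)).
Proof. by move=> L; rewrite -(sq_add L); apply: le_addr. Qed.

(** By the square law [y^2 + xz] equals [(yxz)^2], which lies above [x]; so above a square each
    factor of a summand is itself a summand. *)
Lemma sq_le_letters A v y b w : laws A -> le A (mul A y y) b ->
  w != [::] -> le A (wev A v w) b -> forall n, n \in w -> le A (v n) b.
Proof.
move=> L yb; have factor x z : le A (mul A x z) b -> le A x b.
  move=> /(sq_le_mul L yb); rewrite (mulC L x z) -(mulA L y z x) => H.
  by apply: le_trans H => //; apply: le_sq_mul.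
elim: w => // n r IH _; have [->|r0] := eqVneq r [::].
  by move=> nb k; rewrite inE => /eqP ->.
rewrite wev_cons // => nr k; rewrite inE => /orP[/eqP ->|].
  exact: factor nr.
by apply: IH => //; move: nr; rewrite (mulC L); apply: factor.
Qed.

Lemma sq_le_word A v y b w : laws A -> le A (mul A y y) b -> w != [::] ->
  (forall n, n \in w -> le A (v n) b) -> le A (wev A v w) b.
Proof.
move=> L yb; elim: w => // n r IH _ H; have [r0|r0] := eqVneq r [::].
  by rewrite r0; apply: H; rewrite inE eqxx.
rewrite wev_cons //.
have nb : le A (v n) b by apply: H; rewrite inE eqxx.
have rb : le A (wev A v r) b by apply: IH => // k kr; apply: H; rewrite inE kr orbT.
have := sq_le_mul L (sq_le_mul L yb nb) rb; rewrite (mulA L y).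
by apply: le_trans => //; apply: le_sq_mul.
Qed.

Definition decide (P : Prop) : bool :=
  if excluded_middle_informative P then true else false.

Lemma decideP P : reflect P (decide P).
Proof. by rewrite /decide; case: excluded_middle_informative => H; constructor. Qed.

(* Two vertices joined by an odd walk are adjacent by the path law, so the
   components are complete bipartite. *)
Lemma two_coloring (R : nat -> nat -> Prop) p q :
  (forall x, ~ R x x) -> (forall x y, R x y -> R y x) ->
  (forall x y z u, R x y -> R y z -> R z u -> R x u) -> ~ R p q ->
  exists col : nat -> bool, (forall x y, R x y -> col x <> col y) /\ col p = col q.
Proof.
move=> irr sym path npq.
pose even x y := x = y \/ exists2 z, R x z & R z y.
pose conn x y := even x y \/ R x y.
have even_sym x y : even x y -> even y x.
  by case=> [->|[z /sym xz /sym zy]]; [left|right; exists z].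
have odd_even x y z : R x y -> even y z -> R x z.
  by move=> xy' [<- //|[u yu uz]]; apply: path xy' yu uz.
have even_odd x y z : even x y -> R y z -> R x z.
  by move=> /even_sym yx /sym zy; apply: sym; apply: odd_even zy yx.
have excl x y : even x y -> ~ R x y.
  by move=> /even_sym e /odd_even /(_ e); apply: irr.
have even_trans x y z : even x y -> even y z -> even x z.
  case=> [-> //|[u xu uy]] yz; right; exists u => //.
  exact: odd_even uy yz.
have conn_sym x y : conn x y -> conn y x.
  by case=> [/even_sym|/sym]; [left|right].
have conn_trans x y z : conn x y -> conn y z -> conn x z.
  case=> [e|o] [e'|o'].
  - by left; apply: even_trans e e'.
  - by right; apply: even_odd e o'.
  - by right; apply: odd_even o e'.
  - by left; right; exists y.
(* The representative of a component is [p] or [q] whenever possible. If [p] and [q] are connected,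
   they are so evenly, since they are not adjacent; otherwise each represents its own component.
   Either way both get the colour [true]. *)
pose base x := if decide (conn x p) then p else if decide (conn x q) then q
               else epsilon (inhabits 0) (conn x).
have base_eq x y : conn x y -> base x = base y.
  move=> xy'; suff E : conn x = conn y by rewrite /base E.
  apply: functional_extensionality => z; apply: propositional_extensionality.
  by split; apply: conn_trans => //; apply: conn_sym.
have base_conn x : conn x (base x).
  rewrite /base; case: decideP => // _; case: decideP => // _.
  by apply: epsilon_spec; exists x; left; left.
exists (fun x => decide (even x (base x))); split.
- move=> x y xy'; rewrite -(base_eq x y (or_intror xy')).
  case: (base_conn x) => [e|o].
    case: decideP => // _; case: decideP => // /excl; case; apply: odd_even (sym _ _ xy') e.
  have e : even y (base x) by right; exists x => //; apply: sym.
  by case: decideP => [/excl //|_]; case: decideP.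
- have -> : base p = p by rewrite /base; case: decideP => // -[]; left; left.
  have e : even q (base q).
    rewrite /base; case: decideP => [[//|/sym //]|_].
    by case: decideP => [_|[]]; [left|left; left].
  by case: decideP => [_|[]]; [case: decideP|left].
Qed.
(** * Completeness of the bases *)

Lemma gens_laws m k B : gens m k B -> laws B.
Proof.
move=> gB; apply: common_laws => e ec.
by apply: (gens_basis gB); apply: basis_common.
Qed.

Lemma M2_word v w : w != [::] ->
  wev M2 v w = M2one <-> forall n, n \in w -> v n = M2one.
Proof.
elim: w => // n r IH _; have [->|r0] := eqVneq r [::].
  by split=> [/= vn k|]; [rewrite inE => /eqP ->|apply; rewrite inE].
rewrite wev_cons //; split=> [|H].
  move=> E k; rewrite inE => /orP[/eqP ->|]; first by move: E; rewrite /=; case: (v n).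
  by move: k; apply/(IH r0); move: E; rewrite /=; case: (v n); case: (wev _ _ _).
rewrite H ?inE ?eqxx //; have -> : wev M2 v r = M2one.
  by apply/(IH r0) => k kr; apply: H; rewrite inE kr orbT.
by [].
Qed.

(** [M2] recognises content: sending exactly the letters of [s] to 1 gives [s], hence [t], the value
    1. *)
Lemma M2_content s t q n : satisfies M2 (s, t) -> q \in words t -> n \in q ->
  exists2 w, w \in words s & n \in w.
Proof.
move=> H qt nq; apply: NNPP => no.
have L : laws M2 by apply: (@gens_laws true None); left.
have flat x : le M2 x M2one -> x = M2one by case: x.
pose v k := if has (fun w => k \in w) (words s) then M2one else M2inf.
have : eval M2 v t = M2one.
  have /= <- := H v; apply/(flat_eval _ _ L flat) => w ws.
  apply/(M2_word _ (words_nonempty ws)) => k kw; rewrite /v.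
  by case: hasP => // -[]; exists w.
move/(flat_eval _ _ L flat)/(_ q qt)/(M2_word _ (words_nonempty qt))/(_ n nq).
by rewrite /v; case: hasP => // -[w ws nw]; case: no; exists w.
Qed.

Lemma Scab_word_long v x y z r : wev Scab v [:: x, y, z & r] = Scabinf.
Proof.
rewrite 2?wev_cons //; set u := wev Scab v (z :: r).
by rewrite /=; case: (v x); case: (v y); case: u.
Qed.

(* The valuation sends a variable that is a summand of [s] to [ab] and colours
   the others with [a] and [b]. *)
Lemma Scab_complete A v s t : laws A ->
  (forall x y z, le A (mul A x (mul A y z)) (eval A v s) ->
     exists u, le A (mul A u u) (eval A v s)) ->
  ~ (exists u, le A (mul A u u) (eval A v s)) -> satisfies Scab (s, t) ->
  le A (eval A v t) (eval A v s).
Proof.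
move=> L long nosq H; set U := eval A v s in long nosq *.
have sU w : w \in words s -> le A (wev A v w) U.
  by move: w; apply/eval_le_words => //; apply: le_refl.
have nolong x y z : ~ le A (mul A x (mul A y z)) U by move=> /long.
(* By the tail law [x + xy] lies above [x y^2], a product of three factors. *)
have notail x y : le A x U -> ~ le A (mul A x y) U.
  move=> xU xyU; apply: (nolong x y y).
  have : le A (add A x (mul A x y)) U by apply/add_le.
  by apply: le_trans => //; apply: tail_law.
have nosq' x : ~ le A (mul A x x) U by move=> xx; apply: nosq; exists x.
pose R x y := le A (mul A (v x) (v y)) U.
have Rsym x y : R x y -> R y x by rewrite /R (mulC L).
have Rpath x y z u : R x y -> R y z -> R z u -> R x u.
  move=> Rxy Ryz Rzu; rewrite /R.
  have : le A (add A (mul A (v x) (v y)) (add A (mul A (v y) (v z)) (mul A (v z) (v u)))) U.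
    by do 2![apply/add_le => //; split=> //].
  by apply: le_trans => //; rewrite /le (addC L) (path_law L).
have shape w : w \in words s -> (exists x, w = [:: x]) \/
    exists x y, [/\ w = [:: x; y], [:: x] \notin words s & [:: y] \notin words s].
  case: w => [/words_nonempty //|x [|y [|z r]]] ws.
  - by left; exists x.
  - right; exists x, y; have xy' := sU _ ws; split=> //; apply/negP=> /sU /= xU.
      exact: (notail _ _ xU xy').
    by apply: (notail _ (v x) xU); rewrite (mulC L).
  - have := sU _ ws; by rewrite 2?wev_cons // => /nolong.
have LS : laws Scab by apply: (@gens_laws false (Some true)); right; right.
have flat x : le Scab x Scabab -> x = Scabab by case: x.
(* The labelling gives each word of [s] the value [ab], hence each word of [t] too, while a chosen
   non-adjacent pair receives equal colours. *)
have key p q : ~ R p q -> exists col : nat -> bool, col p = col q /\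
    let lab n := if [:: n] \in words s then Scabab else
                 if has (fun w => n \in w) (words s) then
                   if col n then Scaba else Scabb
                 else Scabinf in
    forall w, w \in words t -> wev Scab lab w = Scabab.
  move=> npq; have [col [colR colpq]] := two_coloring (fun x => @nosq' (v x)) Rsym Rpath npq.
  exists col; split=> //; apply/(flat_eval _ _ LS flat).
  set lab := fun n => _; have /= <- := H lab; apply/(flat_eval _ _ LS flat) => w ws.
  have [[x E]|[x [y [E xs ys]]]] := shape w ws; first by rewrite E in ws *; rewrite /= /lab ws.
  have lx : lab x = if col x then Scaba else Scabb.
    rewrite /lab (negPf xs); case: hasP => // -[]; exists w => //.
    by rewrite E inE eqxx.
  have ly : lab y = if col y then Scaba else Scabb.
    rewrite /lab (negPf ys); case: hasP => // -[]; exists w => //.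
    by rewrite E !inE eqxx orbT.
  have := sU w ws; rewrite E /= lx ly => /colR.
  by case: (col x); case: (col y).
apply/eval_le_words => // q qt; case: q qt => [/words_nonempty //|x [|y [|z r]]] qt.
(* Any non-adjacent pair would do to obtain a colouring; [0, 0] is one since no square lies below
   [U]. *)
- have [col [_ /= /(_ _ qt) /=]] := key 0 0 (@nosq' (v 0)).
  case X: (_ \in words s); first by move/sU: X.
  by case: (has _ _) => //; case: (col x).
(* Were [x] and [y] not adjacent, equal colours would keep the word [xy] from having the value
   [ab]. *)
- apply: NNPP => nxy; have [col [cxy /= /(_ _ qt) /=]] := key x y nxy.
  rewrite cxy; case: ([:: x] \in words s); try case: (has (fun w => x \in w) _);
    case: ([:: y] \in words s); try case: (has (fun w => y \in w) _);
    by case: (col y).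
- have [col [_ /= /(_ _ qt)]] := key 0 0 (@nosq' (v 0)).
  by rewrite Scab_word_long.
Qed.

Lemma basis_complete m k A : Mod (fun e => In e (basis m k)) A -> Vgen (gens m k) A.
Proof.
move=> HA; have L : laws A.
  by apply: common_laws => e ec; apply: HA; apply: basis_common.
suff half s t : Id (gens m k) (s, t) -> forall v, le A (eval A v t) (eval A v s).
  move=> [s t] st v /=; apply: (le_antisym L); apply: half => //.
  by move=> B gB u; apply/esym/(st B gB u).
move=> st v; set U := eval A v s.
have sU w : w \in words s -> le A (wev A v w) U.
  by move: w; apply/eval_le_words => //; apply: le_refl.
have [[y yU]|nosq] := classic (exists y, le A (mul A y y) U).
  apply/eval_le_words => // q qt; case: m HA st => HA st.
    apply: (sq_le_word L yU (words_nonempty qt)) => n nq.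
    have sat2 : satisfies M2 (s, t) by apply: st; left.
    have [w ws nw] := M2_content sat2 qt nq.
    exact: (sq_le_letters L yU (words_nonempty ws) (sU w ws)).
  (* When [M2] is absent, [y^2 = (yz)^2] puts every square above everything. *)
  have zero z : le A z U.
    have : eval A (fun n => if n is 0 then y else z) (sq (Var 0)) =
           eval A (fun n => if n is 0 then y else z) (sq xy).
      by apply: (HA (sq (Var 0), sq xy)); right; left.
    move=> /= E; apply: le_trans yU => //; rewrite E; exact: le_sq_mul.
  exact: zero.
have in_k e : In e (match k with
   | None => [:: (Var 0, sq (Var 0))]
   | Some false => [:: (xy, sq xy)]
   | Some true => [::] end) -> satisfies A e.
  by move=> ek; apply: HA; right; apply/in_app_iff; right; apply/in_app_iff; left.
case: k st in_k {HA} (HA (xyz, sq xyz) (or_introl erefl)) => [[|]|] st in_k law5.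
- apply: Scab_complete => //; last by apply: st; right; right.
  move=> x y z xyzU; exists (mul A x (mul A y z)).
  have /= <- := law5 (fun n => match n with 0 => x | 1 => y | _ => z end).
  exact: xyzU.
- have single w : w \in words s -> exists x, w = [:: x].
    case: w => [/words_nonempty //|x [|y r]] ws; first by exists x.
    case: nosq; exists (mul A (v x) (wev A v (y :: r))).
    have /= <- := in_k (xy, sq xy) (or_introl erefl)
      (fun n => match n with 0 => v x | _ => wev A v (y :: r) end).
    exact: sU _ ws.
  have LS : laws Sca by apply: (@gens_laws false (Some false)); right; left.
  have flat x : le Sca x Scaa -> x = Scaa by case: x.
  pose lab n := if [:: n] \in words s then Scaa else Scainf.
  have : eval Sca lab t = Scaa.
    have /= <- : satisfies Sca (s, t) by apply: st; right; left.
    apply/(flat_eval _ _ LS flat) => w ws; have [x E] := single w ws.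
    by rewrite E in ws *; rewrite /= /lab ws.
  move=> /(flat_eval _ _ LS flat) labt; apply/eval_le_words => // q qt.
  have := labt q qt; case: q qt => [/words_nonempty //|x [|y r]] qt //.
  by rewrite /= /lab; case: ifP => // /sU.
- case: nosq; exists U.
  have /= <- := in_k (Var 0, sq (Var 0)) (or_introl erefl) (fun=> U).
  exact: le_refl.
Qed.

Lemma Vgen_basis m k : same_class (Vgen (gens m k)) (Mod (fun e => In e (basis m k))).
Proof.
move=> A; split; last exact: basis_complete.
by move=> VA e eb; apply: VA => B gB; apply: gens_basis gB _ eb.
Qed.

(** * The generators as divisors of powers of S_7 *)

Definition M2_S7 (b : M2_car) : S7_car := if b is M2one then S7one else S7inf.
Definition S7_M2 (b : S7_car) : M2_car := if b is S7one then M2one else M2inf.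

Lemma V_S7_M2 : V_S7 M2.
Proof.
move=> [s t] H v /=; have := H S7 erefl (fun n => M2_S7 (v n)) => /=.
have D u : eval S7 (fun n => M2_S7 (v n)) u <> S7a /\
    S7_M2 (eval S7 (fun n => M2_S7 (v n)) u) = eval M2 v u.
  apply: (@eval_divisor S7 M2 M2_S7 (fun x => x <> S7a) S7_M2);
    by [case | move=> [] []].
by move=> E; case: (D s) => _ <-; case: (D t) => _ <-; rewrite E.
Qed.

Lemma V_S7_cube B (h : car B -> car S7cube) (D : car S7cube -> Prop) (g : car S7cube -> car B) :
  cube_divisor h D g ->
  V_S7 B.
Proof.
move=> [Dh gh Dadd Dmul] [s t] H v /=.
have [_ <-] := eval_divisor v s Dh gh Dadd Dmul.
have [_ <-] := eval_divisor v t Dh gh Dadd Dmul.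
have {}H := H S7 erefl; rewrite !eval_S7cube.
by congr g; do 2?congr pair; apply: H.
Qed.

Definition Sca_cube (b : Sca_car) : car S7cube :=
  if b is Scaa then (S7a, (S7a, S7a)) else (S7inf, (S7inf, S7inf)).
Definition cube_Sca (p : car S7cube) : Sca_car :=
  if p is (S7a, (S7a, S7a)) then Scaa else Scainf.
Definition Sca_dom (p : car S7cube) : Prop :=
  p = (S7a, (S7a, S7a)) \/ p = (S7inf, (S7inf, S7inf)).

Definition Scab_cube (b : Scab_car) : car S7cube :=
  match b with
  | Scabinf => (S7inf, (S7inf, S7inf))
  | Scaba => (S7a, (S7one, S7one))
  | Scabb => (S7one, (S7a, S7a))
  | Scabab => (S7a, (S7a, S7a))
  end.
Definition cube_Scab (p : car S7cube) : Scab_car :=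
  match p with
  | (S7a, (S7one, S7one)) => Scaba
  | (S7one, (S7a, S7a)) => Scabb
  | (S7a, (S7a, S7a)) => Scabab
  | _ => Scabinf
  end.
(** The triple of units has to be left out: [cube_Scab] sends it to infinity, yet multiplication by
    it fixes every element. *)
Definition Scab_dom (p : car S7cube) : Prop :=
  p.2.1 = p.2.2 /\ p <> (S7one, (S7one, S7one)).

Definition Scabc_cube (b : hcar three) : car S7cube :=
  match b with
  | HInf => (S7inf, (S7inf, S7inf))
  | HTop => (S7a, (S7a, S7a))
  | HV None => (S7a, (S7one, S7one))
  | HV (Some true) => (S7one, (S7a, S7one))
  | HV (Some false) => (S7one, (S7one, S7a))
  | HP None => (S7one, (S7a, S7a))
  | HP (Some true) => (S7a, (S7one, S7a))
  | HP (Some false) => (S7a, (S7a, S7one))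
  end.
Definition cube_Scabc (p : car S7cube) : hcar three :=
  match p with
  | (S7a, (S7a, S7a)) => HTop
  | (S7a, (S7one, S7one)) => HV None
  | (S7one, (S7a, S7one)) => HV (Some true)
  | (S7one, (S7one, S7a)) => HV (Some false)
  | (S7one, (S7a, S7a)) => HP None
  | (S7a, (S7one, S7a)) => HP (Some true)
  | (S7a, (S7a, S7one)) => HP (Some false)
  | _ => HInf
  end.
Definition Scabc_dom (p : car S7cube) : Prop := p <> (S7one, (S7one, S7one)).

Lemma Sca_divisor : @cube_divisor Sca Sca_cube Sca_dom cube_Sca.
Proof.
split.
- by case; [right|left].
- by case.
- by move=> x y [->|->] [->|->]; split=> //; [left|right|right|right].
- by move=> x y [->|->] [->|->]; split=> //; right.
Qed.

Lemma Scab_divisor : @cube_divisor Scab Scab_cube Scab_dom cube_Scab.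
Proof.
split.
- by case.
- by case.
- by move=> [x [y z]] [x' [y' z']]; rewrite /Scab_dom /= => -[/= <- nx] [/= <- ny];
    move: nx ny; case: x; case: y; case: x'; case: y' => // nx ny.
- by move=> [x [y z]] [x' [y' z']]; rewrite /Scab_dom /= => -[/= <- nx] [/= <- ny];
    move: nx ny; case: x; case: y; case: x'; case: y' => // nx ny.
Qed.

Lemma Scabc_divisor : @cube_divisor Scabc Scabc_cube Scabc_dom cube_Scabc.
Proof.
split.
- by case=> [||[[]|]|[[]|]].
- by case=> [||[[]|]|[[]|]].
- by move=> [x [y z]] [x' [y' z']]; rewrite /Scabc_dom;
    case: x; case: y; case: z; case: x'; case: y'; case: z'.
- by move=> [x [y z]] [x' [y' z']]; rewrite /Scabc_dom;
    case: x; case: y; case: z; case: x'; case: y'; case: z'.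
Qed.

(** * Laws forced by omitting each generator *)

(** In [S7] the terms [x^2] and [(xy)^2] add and multiply like the elements 1 and infinity of [M2],
    so an identity failing in [M2] turns into their equality. *)
Lemma M2_absent (V : aclass) : is_variety V -> (forall A, V A -> V_S7 A) ->
  ~ V M2 -> forall A, V A -> satisfies A (sq (Var 0), sq xy).
Proof.
move=> [Sig HV] VS7 nV A VA.
have [[s t] [Sst nst]] : exists d, Sig d /\ ~ satisfies M2 d.
  apply: NNPP => no; apply: nV; apply/HV => d Sd.
  by apply: NNPP => nd; apply: no; exists d.
have [phi /= nphi] := not_all_ex_not _ _ nst.
have st : satisfies A (s, t) by move/HV: VA; apply.
pose wd b := if b is M2one then sq (Var 0) else sq xy.
have word u : satisfies S7 (subst (fun n => wd (phi n)) u, wd (eval M2 phi u)).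
  move=> v; elim: u => //= x -> y ->;
    by case: (eval M2 phi x); case: (eval M2 phi y) => /=; case: (v 0); case: (v 1).
have E : satisfies A (wd (eval M2 phi s), wd (eval M2 phi t)).
  move=> v; have /= <- := V_S7_satisfies (VS7 A VA) (word s) v.
  have /= <- := V_S7_satisfies (VS7 A VA) (word t) v.
  by rewrite !eval_subst; apply: (st (fun n => eval A v (wd (phi n)))).
move: nphi E; case: (eval M2 phi s); case: (eval M2 phi t) => // _ E v.
by apply/esym/E.
Qed.

Lemma Sca_absent (V : aclass) : is_variety V -> (forall A, V A -> V_S7 A) ->
  ~ V Sca -> forall A, V A -> satisfies A (Var 0, sq (Var 0)).
Proof.
move=> VV VS7 nV; apply: (@collapse_of_absent V Sca Scainf Sca_cube Sca_dom cube_Sca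
  (fun b => if b is Scaa then Var 0 else sq (Var 0)) (fun=> None)
  (Var 0) (sq (Var 0)) [:: id] VV VS7 nV Sca_divisor).
- by move=> [] [] v //= _; split=> //; case: (v 0).
- by [].
- by case.
- by move=> r v [<-|].
- by move=> v /= ->.
- by move=> v /= v0; rewrite v0; split=> // -[] /=; rewrite v0.
- move=> v /= v0; rewrite v0; split=> // k; exists id; first by left.
  by move=> b; case: b; case: k => [[]|] /=; rewrite v0.
Qed.

Definition swap2 (n : nat) : nat := if n is 0 then 1 else 0.

Lemma Scab_absent (V : aclass) : is_variety V -> (forall A, V A -> V_S7 A) ->
  ~ V Scab -> forall A, V A -> satisfies A (xy, sq xy).
Proof.
move=> VV VS7 nV; apply: (@collapse_of_absent V Scab Scabinf Scab_cube Scab_dom cube_Scab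
  (fun b => match b with Scaba => Var 0 | Scabb => Var 1 | Scabab => xy
                       | Scabinf => sq xy end)
  (fun b => match b with Scaba => Some (Var 1) | Scabb => Some (Var 0) | _ => None end)
  xy (sq xy) [:: id; swap2] VV VS7 nV Scab_divisor).
- by move=> [] [] v //= _; split=> //; case: (v 0); case: (v 1).
- by move=> [] [] v //= _; split=> //; case: (v 0); case: (v 1).
- by move=> [] v //= _; case: (v 0); case: (v 1).
- by move=> r v [<-|[<-|]] //=; case: (v 0); case: (v 1).
- by move=> v /= ->.
- by move=> v /=; case E0: (v 0); case E1: (v 1) => // _; split=> // -[] /=; rewrite ?E0 ?E1.
- move=> v /=; case E0: (v 0); case E1: (v 1) => // _; split=> //.
  + case=> [b|].
      by exists swap2; [right; left|case; case: b => /=; rewrite ?E0 ?E1].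
    by exists id; [left|case=> /=; rewrite ?E0 ?E1].
  + case=> [b|].
      by exists id; [left|case; case: b => /=; rewrite ?E0 ?E1].
    by exists swap2; [right; left|case=> /=; rewrite ?E0 ?E1].
Qed.

Definition rot3 (n : nat) : nat := match n with 0 => 1 | 1 => 2 | _ => 0 end.
Definition rot3' (n : nat) : nat := match n with 0 => 2 | 1 => 0 | _ => 1 end.

Definition Scabc_word (b : hcar three) : term :=
  match b with
  | HInf => sq xyz
  | HTop => xyz
  | HV None => Var 0
  | HV (Some true) => Var 1
  | HV (Some false) => Var 2
  | HP None => Mul (Var 1) (Var 2)
  | HP (Some true) => Mul (Var 0) (Var 2)
  | HP (Some false) => Mul (Var 0) (Var 1)
  end.

Definition Scabc_complement (b : hcar three) : option term :=
  match b with
  | HV i => Some (Scabc_word (HP i))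
  | HP i => Some (Scabc_word (HV i))
  | _ => None
  end.

Lemma Scabc_absent (V : aclass) : is_variety V -> (forall A, V A -> V_S7 A) ->
  ~ V Scabc -> forall A, V A -> satisfies A (xyz, sq xyz).
Proof.
move=> VV VS7 nV; apply: (@collapse_of_absent V Scabc HInf Scabc_cube Scabc_dom cube_Scabc
  Scabc_word Scabc_complement xyz (sq xyz) [:: fun n => n; rot3; rot3'] VV VS7 nV Scabc_divisor).
- by move=> [||[[]|]|[[]|]] [||[[]|]|[[]|]] v //= _; split=> //;
    case: (v 0); case: (v 1); case: (v 2).
- by move=> [||[[]|]|[[]|]] [||[[]|]|[[]|]] v //= _; split=> //;
    case: (v 0); case: (v 1); case: (v 2).
- by move=> [||[[]|]|[[]|]] v //= _; case: (v 0); case: (v 1); case: (v 2).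
- by move=> r v [<-|[<-|[<-|]]] //=; case: (v 0); case: (v 1); case: (v 2).
- by move=> v /= ->.
- move=> v /=; case E0: (v 0); case E1: (v 1); case E2: (v 2) => // _; split=> //.
  by case=> [||[[]|]|[[]|]] /=; rewrite ?E0 ?E1 ?E2.
- have fits (v : nat -> S7_car) (r : nat -> nat) k : [/\ v (r 0) = coord k (S7a, (S7one, S7one)),
      v (r 1) = coord k (S7one, (S7a, S7one)) &
      v (r 2) = coord k (S7one, (S7one, S7a))] ->
      forall b, eval S7 (fun n => v (r n)) (Scabc_word b) = coord k (Scabc_cube b).
    case=> E0 E1 E2; case=> [||[[]|]|[[]|]] /=; rewrite ?E0 ?E1 ?E2;
    by case: k {E0 E1 E2} => [[]|].
  (* Exactly one of the three letters has the value [S7a], and a cyclic shift brings it to the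
     position that [k] prescribes. *)
  have find (v : nat -> S7_car) k : eval S7 v xyz = S7a ->
      exists2 r, In r [:: fun n => n; rot3; rot3'] &
      [/\ v (r 0) = coord k (S7a, (S7one, S7one)),
      v (r 1) = coord k (S7one, (S7a, S7one)) &
      v (r 2) = coord k (S7one, (S7one, S7a))].
    rewrite /=; case E0: (v 0); case E1: (v 1); case E2: (v 2) => // _;
    case: k => [[]|];
    solve [ exists (fun n => n); [by left | by rewrite /= ?E0 ?E1 ?E2]
     | exists rot3; [by right; left | by rewrite /= ?E0 ?E1 ?E2]
     | exists rot3'; [by right; right; left | by rewrite /= ?E0 ?E1 ?E2] ].
  move=> v a; split=> [|k].
    by move: a; rewrite /=; case: (v 0); case: (v 1); case: (v 2).
  by have [r rr vr] := find v k a; exists r => //; apply: fits vr.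
Qed.

(** * Classification *)

Lemma gens_V_S7 m k B : gens m k B -> V_S7 B.
Proof.
case=> [[_ ->]|[[_ ->]|[_ ->]]]; first exact: V_S7_M2.
- exact: V_S7_cube Sca_divisor.
- exact: V_S7_cube Scab_divisor.
Qed.

Lemma Vgen_V_S7 m k A : Vgen (gens m k) A -> V_S7 A.
Proof.
move=> VA e He; apply: VA => B gB.
by apply: V_S7_satisfies (gens_V_S7 gB) _; apply: He.
Qed.

Lemma classification (V : aclass) : is_variety V -> (forall A, V A -> V_S7 A) ->
  ~ V Scabc -> exists m k, same_class V (Vgen (gens m k)).
Proof.
move=> VV VS7 nV.
pose m := decide (V M2).
pose k := if decide (V Scab) then Some true
          else if decide (V Sca) then Some false else None.
exists m, k => A; split=> [VA|].
  apply: basis_complete => e; rewrite /basis => -[<-|].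
    exact: Scabc_absent VA.
  case/in_app_iff=> [|/in_app_iff[]].
  - rewrite /m; case: decideP => // nM [<-|//]; exact: M2_absent VA.
  - rewrite /k; case: decideP => // nab; case: decideP => na [<-|//].
      exact: Scab_absent VA.
    exact: Sca_absent VA.
  - by move=> /S7_common; apply: V_S7_satisfies; apply: VS7.
case: VV => Sig HV VA; apply/HV => e Se; apply: VA => B gB.
suff /HV : V B by apply.
case: gB => [[+ ->]|[[+ ->]|[+ ->]]].
- by rewrite /m; case: decideP.
- by rewrite /k; case: decideP => // _; case: decideP.
- by rewrite /k; case: decideP => // _; case: decideP.
Qed.

Lemma Vgen_M2 m k : Vgen (gens m k) M2 <-> m = true.
Proof.
split=> [/Vgen_basis|->]; last by move=> e; apply; left.
case: m => // /(_ (sq (Var 0), sq xy)) /(_ (or_intror (or_introl erefl))).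
by move=> /(_ (fun n => if n is 0 then M2one else M2inf)).
Qed.

Lemma Vgen_Scab m k : Vgen (gens m k) Scab <-> k = Some true.
Proof.
split=> [/Vgen_basis H|->]; last by move=> e; apply; right; right.
have in_k e : In e (match k with
   | None => [:: (Var 0, sq (Var 0))]
   | Some false => [:: (xy, sq xy)]
   | Some true => [::] end) -> satisfies Scab e.
  by move=> ek; apply: H; right; apply/in_app_iff; right; apply/in_app_iff; left.
case: k {H} in_k => [[]|] // /(_ _ (or_introl erefl));
  by move=> /(_ (fun n => if n is 0 then Scaba else Scabb)).
Qed.

Lemma Vgen_Sca m k : Vgen (gens m k) Sca <-> k <> None.
Proof.
split=> [/Vgen_basis H k0|].
  have : satisfies Sca (Var 0, sq (Var 0)).
    by apply: H; right; apply/in_app_iff; right; apply/in_app_iff; left; rewrite k0; left.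
  by move=> /(_ (fun=> Scaa)).
case: k => [[|]|] // _ [s t] H; last by apply: H; right; left.
(* [Sca] is the subalgebra of [Scab] formed by [ab] and infinity. *)
have D v u := @eval_divisor Scab Sca (fun b => if b is Scaa then Scabab else Scabinf)
  (fun x => x = Scabab \/ x = Scabinf) (fun x => if x is Scabab then Scaa else Scainf) v u.
have st : satisfies Scab (s, t) by apply: H; right; right.
move=> v /=; have E u := D v u; move: (E s) (E t).
by do 2![case; [by case; auto|by case|by move=> x y [->|->] [->|->] /=; auto
  |by move=> x y [->|->] [->|->] /=; auto|move=> _ <-]]; congr (if _ is Scabab then _ else _); apply: st.
Qed.

(** Membership of [M2], [Sca] and [Scab] determines the two parameters. *)
Lemma gens_inj m k m' k' :
  same_class (Vgen (gens m k)) (Vgen (gens m' k')) -> m = m' /\ k = k'.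
Proof.
move=> E; have := E M2; have := E Scab; have := E Sca.
rewrite !Vgen_M2 !Vgen_Sca !Vgen_Scab.
by move: m m' k k' {E} => [] [] [[]|] [[]|]; intuition congruence.
Qed.

Definition six_gens (i : nat) : bool * option bool :=
  match i with
  | 0 => (false, None) | 1 => (true, None) | 2 => (false, Some false)
  | 3 => (false, Some true) | 4 => (true, Some false) | _ => (true, Some true)
  end.

Lemma six_varietiesE i : (i < 6)%N ->
  same_class (List.nth i six_varieties trivial_variety)
             (Vgen (gens (six_gens i).1 (six_gens i).2)).
Proof.
have Vgen_ext K K' : (forall A, K A <-> K' A) -> same_class (Vgen K) (Vgen K').
  by move=> E A; split=> H e He; apply: H => B /E; apply: He.
do 6?[case: i => [_|i]] => //=; try by apply: Vgen_ext => A; rewrite /gens; intuition congruence.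
move=> A; split=> [triv e _ v|H x y]; first exact: triv.
(* Without generators every identity holds vacuously, in particular [x = y]. *)
have K : Id (gens false None) (Var 0, Var 1) by move=> B [[]|[[]|[]]].
exact: (H _ K (fun n => if n is 0 then x else y)).
Qed.

Lemma six_index (m : bool) (k : option bool) : exists2 i, (i < 6)%N & six_gens i = (m, k).
Proof.
by case: m; case: k => [[|]|]; [exists 5|exists 4|exists 1|exists 3|exists 2|exists 0].
Qed.

Lemma six_nth W : In W six_varieties ->
  exists2 i, (i < 6)%N & W = List.nth i six_varieties trivial_variety.
Proof.
by move=> /(In_nth _ _ trivial_variety) [i [/ltP i6 <-]]; exists i.
Qed.

Lemma six_subvarieties W : In W six_varieties ->
  subvariety W V_S7 /\ finitely_based W.
Proof.
move=> /six_nth[i i6 ->]; have E := six_varietiesE i6.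
set W0 := List.nth _ _ _ in E *; case: (six_gens i) E => m k /= E.
have EB : same_class W0 (Mod (fun e => In e (basis m k))).
  by move=> A; rewrite E; apply: Vgen_basis.
split; last by exists (basis m k).
split=> [|A /E]; last exact: Vgen_V_S7.
by exists (fun e => In e (basis m k)).
Qed.

Lemma six_distinct i j : (i < 6)%coq_nat -> (j < 6)%coq_nat -> i <> j ->
  ~ same_class (List.nth i six_varieties trivial_variety)
               (List.nth j six_varieties trivial_variety).
Proof.
move=> /ltP i6 /ltP j6 ij E; apply: ij.
have [] : (six_gens i).1 = (six_gens j).1 /\ (six_gens i).2 = (six_gens j).2.
  by apply: gens_inj => A; rewrite -(six_varietiesE i6) -(six_varietiesE j6).
by case: i i6 {E} => [|[|[|[|[|[|i]]]]]] // _; case: j j6 => [|[|[|[|[|[|j]]]]]].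
Qed.

Lemma six_exhaustive V : subvariety V V_S7 ->
  (finitely_based V <-> exists W, In W six_varieties /\ same_class V W).
Proof.
move=> [VV VS7]; split=> [fb|[W [/six_subvarieties [_ [L HL]] VW]]]; last first.
  by exists L => A; rewrite VW.
have nV : ~ V Scabc by move=> VS; apply: nonfinitely_based VS VS7 fb.
have [m [k E]] := classification VV VS7 nV.
have [i i6 Ei] := six_index m k.
exists (List.nth i six_varieties trivial_variety); split.
  by apply: nth_In; apply/ltP.
by move=> A; rewrite E (six_varietiesE i6) Ei.
Qed.

End Development.

Theorem theorem3p16 :
  (* each of the six listed classes is a finitely based subvariety of V(S_7) *)
  (forall W, In W six_varieties -> subvariety W V_S7 /\ finitely_based W) /\
  (* the six are pairwise distinct *)
  (forall i j : nat, i < 6 -> j < 6 -> i <> j ->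
     ~ same_class (nth i six_varieties trivial_variety)
                  (nth j six_varieties trivial_variety)) /\
  (* a subvariety of V(S_7) is finitely based iff it is one of the six *)
  (forall V : aclass, subvariety V V_S7 ->
     (finitely_based V <-> exists W, In W six_varieties /\ same_class V W)).
Proof.
exact (conj six_subvarieties (conj six_distinct six_exhaustive)).
Qed.
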